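(* Let $X\subseteq\{0,1\}^{\mathbb Z}$ be a measure-theoretically subordinate subshift with base measure $\nu$ such that $h(\nu)=0$. Then $h_{top}(X)=\nu(1)$. Moreover, $X$ is intrinsically ergodic and its unique measure of maximal entropy is $M_*(\nu\otimes B_{1/2})$.
   Context: $\sigma$ is the left shift on $\{0,1\}^{\mathbb Z}$; $\mathcal M(Y)$ is the set of shift-invariant Borel probability measures on $Y$; $\nu(1)=\nu(\{x:x_0=1\})$; entropies use logarithm base 2. $B_{1/2}$ is the $(1/2,1/2)$ Bernoulli measure on $\{0,1\}^{\mathbb Z}$. $M(x,y)=x\cdot y$ coordinatewise, $\pi_1$ the first-coordinate projection. A subshift $X$ is a measure-theoretically subordinate subshift with base measure $\nu$ if $\mathcal M(X)=\{M_*(\lambda):\lambda\in\mathcal M((\{0,1\}^{\mathbb Z})^2,\sigma^{\times2}),(\pi_1)_*\lambda=\nu\}$. Intrinsically ergodic means there is exactly one invariant measure of maximal entropy. *)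

(* Defs.v *)
From HB Require Import structures.
From mathcomp Require Import all_boot all_order all_algebra.
From mathcomp Require Import all_classical all_reals all_analysis.
Set Implicit Arguments.
Unset Strict Implicit.
Unset Printing Implicit Defensive.
Import Order.TTheory GRing.Theory Num.Theory.
Import numFieldTopology.Exports.
Local Open Scope classical_set_scope.
Local Open Scope ring_scope.

Definition fullshift_top : Type := prod_topology (fun _ : int => bool).
HB.instance Definition _ := Pointed.on fullshift_top.
HB.instance Definition _ := Nbhs.on fullshift_top.
HB.instance Definition _ := Topological.on fullshift_top.

Definition fullshift : Type := g_sigma_algebraType (@open fullshift_top).
HB.instance Definition _ := Pointed.on fullshift.
HB.instance Definition _ := Measurable.on fullshift.

Definition shift (x : fullshift) : fullshift := fun i => x (i + 1)%R.

Definition shift2 (p : fullshift * fullshift) : fullshift * fullshift :=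
  (shift p.1, shift p.2).

Definition mulM (p : fullshift * fullshift) : fullshift :=
  fun i => (p.1 i && p.2 i).

Definition subshift (X : set fullshift) : Prop :=
  closed (X : set fullshift_top) /\ shift @` X = X.

Definition invariant_on {R : realType} (Y : set fullshift)
    (mu : probability fullshift R) : Prop :=
  mu Y = 1%E /\
  forall A : set fullshift, measurable A -> mu (shift @^-1` A) = mu A.

Definition invariant2 {R : realType}
    (lam : probability (fullshift * fullshift)%type R) : Prop :=
  forall A : set (fullshift * fullshift), measurable A ->
    lam (shift2 @^-1` A) = lam A.

Definition mt_subordinate {R : realType} (X : set fullshift)
    (nu : probability fullshift R) : Prop :=
  subshift X /\
  forall mu : probability fullshift R,
    invariant_on X mu <->
    exists lam : probability (fullshift * fullshift)%type R,
      invariant2 lam /\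
      (forall A, measurable A -> pushforward lam fst A = nu A) /\
      (forall A, measurable A -> pushforward lam mulM A = mu A).

Definition cyl (n : nat) (w : n.-tuple bool) : set fullshift :=
  [set x | forall i : 'I_n, x (i%:Z) = tnth w i].

Definition cyl_at (m : int) (n : nat) (w : n.-tuple bool) : set fullshift :=
  [set x | forall i : 'I_n, x (m + i%:Z)%R = tnth w i].

Definition log2 {R : realType} (t : R) : R := ln t / ln 2.

Definition etaH {R : realType} (t : R) : R :=
  if t == 0 then 0 else - (t * log2 t).

Definition Hn {R : realType} (mu : set fullshift -> \bar R) (n : nat) : R :=
  \sum_(w : n.-tuple bool) etaH (fine (mu (cyl w))).

(** Measure-theoretic (Kolmogorov-Sinai) entropy of a shift-invariant measure,
    computed with the generating time-zero partition:
    h(mu) = lim_n H_n(mu)/n. *)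
Definition ment {R : realType} (mu : set fullshift -> \bar R) : R :=
  limn (fun n : nat => Hn mu n / n%:R).

Definition lang (X : set fullshift) (n : nat) : {set n.-tuple bool} :=
  [set w : n.-tuple bool | `[< exists2 x, X x & cyl w x >]].

Definition htop {R : realType} (X : set fullshift) : R :=
  limn (fun n : nat => @log2 R (#|lang X n|%:R) / n%:R).

Definition one_freq {R : realType} (nu : set fullshift -> \bar R) : R :=
  fine (nu [set x | x 0 = true]).

Definition is_mme {R : realType} (X : set fullshift)
    (mu : probability fullshift R) : Prop :=
  invariant_on X mu /\ ment mu = htop X.

Definition intrinsically_ergodic {R : realType} (X : set fullshift) : Prop :=
  (exists mu : probability fullshift R, is_mme X mu) /\
  (forall mu1 mu2 : probability fullshift R, is_mme X mu1 -> is_mme X mu2 ->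
     forall A, measurable A -> mu1 A = mu2 A).

Definition bernoulli_half {R : realType} (B : probability fullshift R) : Prop :=
  forall (m : int) (n : nat) (w : n.-tuple bool),
    B (cyl_at m w) = ((2%:R : R) ^- n)%:E.

(* Main.v *)
Require Import Defs.
From HB Require Import structures.
From mathcomp Require Import all_boot all_order all_algebra.
From mathcomp Require Import all_classical all_reals all_analysis.
From mathcomp Require Import ring lra zify.
Import Order.TTheory GRing.Theory Num.Theory.
Import numFieldNormedType.Exports.
Local Open Scope classical_set_scope.
Local Open Scope ring_scope.

Set Implicit Arguments.
Unset Strict Implicit.
Unset Printing Implicit Defensive.

(** Let [lam] be a joining with first marginal [nu] and let [(x, z)], with
    [z = x y], be the associated pair of processes.  Since [z] vanishes where
    [x] does and is otherwise one bit, H(z_0..z_{n-1} | x_0..x_{n-1}) is at most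
    [n nu(1)], with equality exactly when, given the word of [x], the word of
    [z] is uniform among the words below it, i.e. when the joint law of the
    words is that of [nu (x) B_{1/2}].  As h(nu) = 0 and conditional block
    entropy is subadditive, every measure of [M(X)] has entropy at most [nu(1)],
    with equality only for [M_*(nu (x) B_{1/2})], for which H_n >= n nu(1).

    The bound htop(X) <= nu(1) is the hard half of the variational principle.
    Along an ultrafilter the empirical measures of the words of [X] converge to
    an invariant measure [mu] on [X]; Gibbs' inequality between the uniform law
    on the words of length [n] and Markov chains whose transitions come from
    [(mu + uniform) / 2] gives m htop(X) <= H_m(mu) + 1 for all [m].  The limit
    is at first only finitely additive; it is realised by a measure by coding
    Lebesgue measure on [0, 1) through the inverse distribution function. *)

(** * Finite entropy *)

Definition ent {R : realType} (T : finType) (p : T -> R) : R :=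
  \sum_t etaH (p t).

Definition push {R : realType} (T S : finType) (h : T -> S) (p : T -> R)
  (s : S) : R := \sum_(t | h t == s) p t.

Lemma ln2_gt0 (R : realType) : 0 < ln 2 :> R.
Proof. by rewrite ln_gt0// ltr1n. Qed.

Lemma etaHE (R : realType) (t : R) : etaH t = - (t * log2 t).
Proof. by rewrite /etaH; case: eqP => // ->; rewrite mul0r oppr0. Qed.

Lemma log2M (R : realType) (x y : R) :
  0 < x -> 0 < y -> log2 (x * y) = log2 x + log2 y.
Proof. by move=> x0 y0; rewrite /log2 lnM ?posrE// mulrDl. Qed.

Lemma log2V (R : realType) (x : R) : 0 < x -> log2 x^-1 = - log2 x.
Proof. by move=> x0; rewrite /log2 lnV ?posrE// mulNr. Qed.

Lemma log2_1 (R : realType) : log2 (1 : R) = 0.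
Proof. by rewrite /log2 ln1 mul0r. Qed.

Lemma log2_2 (R : realType) : log2 (2 : R) = 1.
Proof. by rewrite /log2 divff// gt_eqF// ln2_gt0. Qed.

Lemma ler_log2 (R : realType) (x y : R) :
  0 < x -> x <= y -> log2 x <= log2 y.
Proof.
move=> x0 xy; rewrite /log2 ler_pM2r ?invr_gt0 ?ln2_gt0//.
by rewrite ler_ln// posrE// (lt_le_trans x0).
Qed.

Lemma log2_le0 (R : realType) (x : R) : x <= 1 -> log2 x <= 0.
Proof.
by move=> x1; rewrite /log2 pmulr_lle0 ?invr_gt0 ?ln2_gt0// ln_le0.
Qed.

Lemma etaH_ge0 (R : realType) (x : R) : 0 <= x <= 1 -> 0 <= etaH x.
Proof.
by move=> /andP[x0 x1]; rewrite etaHE oppr_ge0 mulr_ge0_le0// log2_le0.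
Qed.

(** This is ln u <= u - 1 at u = q / p, multiplied by p. The implication from q = 0 to p = 0 is
    absolute continuity. *)
Lemma gibbs_term (R : realType) (p q : R) : 0 <= p -> 0 <= q ->
  (q = 0 -> p = 0) -> p - q <= p * (ln p - ln q).
Proof.
move=> p0 q0 qp; have [->|pN0] := eqVneq p 0.
  by rewrite mul0r sub0r oppr_le0.
have pgt0 : 0 < p by rewrite lt_neqAle eq_sym pN0.
have qgt0 : 0 < q.
  by rewrite lt_neqAle q0 andbT eq_sym; apply/eqP => /qp/eqP; exact/negP.
have : ln (q / p) <= q / p - 1.
  rewrite -[in X in X <= _](subrKC 1 (q / p)) le_ln1Dx//.
  by rewrite ltrBrDl subrr divr_gt0.
rewrite ln_div ?posrE// => h.
have : p * (ln q - ln p) <= p * (q / p - 1) by rewrite ler_pM2l.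
by rewrite [X in _ <= X](_ : _ = q - p); [lra|field; exact/eqP/eqP].
Qed.

(** The exponential lies strictly above its tangent at 0 everywhere else, so equality forces ln (q /
    p) = 0. *)
Lemma gibbs_term_eq (R : realType) (p q : R) : 0 <= p -> 0 <= q ->
  (q = 0 -> p = 0) -> p * (ln p - ln q) = p - q -> p = q.
Proof.
move=> p0 q0 qp; have [->|pN0] := eqVneq p 0.
  by rewrite mul0r sub0r => /eqP; rewrite eq_sym oppr_eq0 => /eqP.
have pgt0 : 0 < p by rewrite lt_neqAle eq_sym pN0.
have qgt0 : 0 < q.
  by rewrite lt_neqAle q0 andbT eq_sym; apply/eqP => /qp/eqP; exact/negP.
move=> h; have [e|ne] := eqVneq (ln (q / p)) 0.
  have /eqP := e; rewrite ln_eq0 ?divr_gt0// => /eqP e1.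
  by rewrite -[LHS]mul1r -e1 divfK.
have := expR_gt1Dx ne; rewrite lnK ?posrE ?divr_gt0// ln_div ?posrE// => h1.
have : p * (1 + (ln q - ln p)) < p * (q / p) by rewrite ltr_pM2l.
rewrite [X in _ < X](_ : _ = q); last by field.
by rewrite mulrDr; lra.
Qed.

(** Sum of the bounds [gibbs_term]. Asking only that the mass of q be at most that of p spares an
    exact computation of it in [ent_cond_subadd]. *)
Lemma gibbs (R : realType) (T : finType) (p q : T -> R) :
  (forall t, 0 <= p t) -> (forall t, 0 <= q t) ->
  (forall t, q t = 0 -> p t = 0) -> \sum_t q t <= \sum_t p t ->
  ent p <= \sum_t - (p t * log2 (q t)).
Proof.
move=> p0 q0 qp sqp; rewrite -subr_ge0 -sumrB.
rewrite [leRHS](_ : _ = (\sum_t p t * (ln (p t) - ln (q t))) / ln 2).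
  rewrite divr_ge0 ?(ltW (ln2_gt0 _))// (@le_trans _ _ (\sum_t (p t - q t)))//.
    by rewrite sumrB subr_ge0.
  by apply: ler_sum => t _; apply: gibbs_term => //; exact: qp.
rewrite mulr_suml; apply: eq_bigr => t _; rewrite etaHE /log2.
by rewrite opprK mulrBr mulrBl !mulrA addrC.
Qed.

(** The defects of the termwise inequalities are nonnegative with nonpositive sum; hence each is 0
    and [gibbs_term_eq] applies. *)
Lemma gibbs_eq (R : realType) (T : finType) (p q : T -> R) :
  (forall t, 0 <= p t) -> (forall t, 0 <= q t) ->
  (forall t, q t = 0 -> p t = 0) -> \sum_t q t <= \sum_t p t ->
  \sum_t - (p t * log2 (q t)) <= ent p -> p =1 q.
Proof.
move=> p0 q0 qp sqp le t.
apply: gibbs_term_eq => //; first exact: qp.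
apply/eqP; rewrite -subr_eq0.
have dp s : 0 <= p s * (ln (p s) - ln (q s)) - (p s - q s).
  by rewrite subr_ge0; apply: gibbs_term => //; exact: qp.
have : \sum_t (p t * (ln (p t) - ln (q t)) - (p t - q t)) <= 0.
  rewrite sumrB sumrB subr_le0 (@le_trans _ _ 0) ?subr_ge0//.
  rewrite -(pmulr_lle0 _ (_ : 0 < (ln 2)^-1)) ?invr_gt0 ?ln2_gt0//.
  rewrite [leLHS](_ : _ = \sum_t - (p t * log2 (q t)) - ent p) ?subr_le0//.
  rewrite -sumrB mulr_suml; apply: eq_bigr => s _; rewrite etaHE /log2.
  by rewrite opprK mulrBr mulrBl !mulrA addrC.
move=> s0; have /eqP : \sum_t (p t * (ln (p t) - ln (q t)) - (p t - q t)) = 0.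
  by apply/eqP; rewrite eq_le s0 sumr_ge0.
by rewrite psumr_eq0// => /allP/(_ t (mem_index_enum t)).
Qed.

Lemma push_ge0 (R : realType) (T S : finType) (h : T -> S) (p : T -> R) s :
  (forall t, 0 <= p t) -> 0 <= push h p s.
Proof. by move=> p0; apply: sumr_ge0 => t _. Qed.

Lemma push_eq0 (R : realType) (T S : finType) (h : T -> S) (p : T -> R) t :
  (forall t, 0 <= p t) -> push h p (h t) = 0 -> p t = 0.
Proof.
by move=> p0 /eqP; rewrite psumr_eq0// => /allP/(_ t (mem_index_enum t));
  rewrite eqxx => /eqP.
Qed.

Lemma le_push (R : realType) (T S : finType) (h : T -> S) (p : T -> R) t :
  (forall t, 0 <= p t) -> p t <= push h p (h t).
Proof.
by move=> p0; rewrite /push (bigD1 t) ?eqxx//= lerDl sumr_ge0.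
Qed.

Lemma sum_push (R : realType) (T S : finType) (h : T -> S) (p : T -> R)
  (g : S -> R) : \sum_s push h p s * g s = \sum_t p t * g (h t).
Proof.
rewrite [RHS](partition_big h xpredT)//=; apply: eq_bigr => s _.
by rewrite mulr_suml; apply: eq_bigr => t /eqP ->.
Qed.

Lemma sum_push1 (R : realType) (T S : finType) (h : T -> S) (p : T -> R) :
  \sum_s push h p s = \sum_t p t.
Proof.
by rewrite [RHS](partition_big h xpredT).
Qed.

Lemma push_comp (R : realType) (T S U : finType) (h : T -> S) (g : S -> U)
  (p : T -> R) : push (g \o h) p =1 push g (push h p).
Proof.
move=> u; rewrite /push (partition_big h (fun s => g s == u))//=.
apply: eq_bigr => s /eqP gs; apply: eq_bigl => t.
by case: (h t =P s) => [->|]; rewrite ?gs ?eqxx ?andbF.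
Qed.

Lemma eq_ent (R : realType) (T : finType) (p q : T -> R) :
  p =1 q -> ent p = ent q.
Proof. by move=> pq; apply: eq_bigr => t _; rewrite pq. Qed.

(** Both entropies are written as sums over [T]; a fibre weighs at least as much as each of its
    points, and the logarithm is increasing. *)
Lemma ent_push_le (R : realType) (T S : finType) (h : T -> S) (p : T -> R) :
  (forall t, 0 <= p t) -> ent (push h p) <= ent p.
Proof.
move=> p0; rewrite /ent.
under eq_bigr do rewrite etaHE -mulrN.
rewrite (sum_push h p (fun s => - log2 (push h p s))).
apply: ler_sum => t _; rewrite etaHE mulrN lerN2.
have [->|pN0] := eqVneq (p t) 0; first by rewrite !mul0r.
have pt : 0 < p t by rewrite lt_neqAle eq_sym pN0 p0.
by rewrite ler_pM2l// ler_log2// le_push.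
Qed.

(** Gibbs' inequality against the uniform law on [A]. *)
Lemma ent_le_log_card (R : realType) (T : finType) (p : T -> R) (A : {set T}) :
  (forall t, 0 <= p t) -> \sum_t p t = 1 -> (forall t, p t != 0 -> t \in A) ->
  ent p <= log2 #|A|%:R.
Proof.
move=> p0 p1 pA.
have A0 : (0 < #|A|)%N.
  rewrite lt0n; apply/negP => /eqP/cards0_eq A0.
  suff : \sum_t p t = 0 by rewrite p1 => /eqP; rewrite oner_eq0.
  apply: big1 => t _; apply/eqP/negP => /negP/pA.
  by rewrite A0 inE.
have A0' : 0 < #|A|%:R :> R by rewrite ltr0n.
apply: (@le_trans _ _ (\sum_t - (p t * log2 ((t \in A)%:R / #|A|%:R)))).
  apply: gibbs => //.
  - move=> t; case: (boolP (t \in A)) => [_ /eqP|tA _].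
      by rewrite mul1r invr_eq0 gt_eqF.
    by apply/eqP/negP => /negP/pA; exact/negP.
  - by rewrite -mulr_suml -natr_sum -big_mkcond/= sum1_card p1 divff// gt_eqF.
rewrite (eq_bigr (fun t => p t * log2 #|A|%:R)); last first.
  move=> t _; have [->|/pA ->] := eqVneq (p t) 0.
    by rewrite !mul0r oppr0.
  by rewrite mul1r log2V// mulrN opprK.
by rewrite -mulr_suml p1 mul1r.
Qed.

(* Gibbs' inequality against the law that makes the two coordinates
   independent given their images. *)
Lemma ent_cond_subadd (R : realType) (A B A' B' : finType) (f : A -> A')
  (g : B -> B') (p : A * B -> R) :
  (forall t, 0 <= p t) -> \sum_t p t = 1 ->
  ent p - ent (push (fun t => (f t.1, g t.2)) p) <=
  (ent (push fst p) - ent (push (f \o fst) p)) +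
  (ent (push snd p) - ent (push (g \o snd) p)).
Proof.
move=> p0 p1.
set r := push (fun t => (f t.1, g t.2)) p.
set p1' := push fst p; set r1 := push (f \o fst) p.
set p2' := push snd p; set r2 := push (g \o snd) p.
(* The reference law [q] is r(f a, g b) times the conditional weights of a given f a and of b given
   g b. *)
pose F ab := r ab / (r1 ab.1 * r2 ab.2).
pose q t := p1' t.1 * p2' t.2 * F (f t.1, g t.2).
have r_ge0 t : 0 <= r t by exact: push_ge0.
have r1_ge0 t : 0 <= r1 t by exact: push_ge0.
have r2_ge0 t : 0 <= r2 t by exact: push_ge0.
have p1_ge0 t : 0 <= p1' t by exact: push_ge0.
have p2_ge0 t : 0 <= p2' t by exact: push_ge0.
have pos t : 0 < p t -> [/\ 0 < r (f t.1, g t.2), 0 < p1' t.1,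
    0 < r1 (f t.1), 0 < p2' t.2 & 0 < r2 (g t.2)].
  move=> pt; split; apply: (lt_le_trans pt).
  - exact: (@le_push _ _ _ (fun t => (f t.1, g t.2)) p t).
  - exact: (@le_push _ _ _ fst p t).
  - exact: (@le_push _ _ _ (f \o fst) p t).
  - exact: (@le_push _ _ _ snd p t).
  - exact: (@le_push _ _ _ (g \o snd) p t).
have q0 t : 0 <= q t.
  by rewrite /q /F !mulr_ge0 ?invr_ge0 ?mulr_ge0.
have qp t : q t = 0 -> p t = 0.
  move=> qt; apply/eqP/negP => /negP pN0.
  have pt : 0 < p t by rewrite lt_neqAle eq_sym pN0 p0.
  have [h1 h2 h3 h4 h5] := pos _ pt.
  suff : 0 < q t by rewrite qt ltxx.
  by rewrite /q /F; rewrite !mulr_gt0 ?invr_gt0 ?mulr_gt0.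
have q1 : \sum_t q t <= \sum_t p t.
  rewrite p1 -(pair_bigA _ (fun a b => q (a, b)))/= /q /=.
  rewrite (eq_bigr (fun a => p1' a * (\sum_b r2 b * F (f a, b)))); last first.
    move=> a _; under eq_bigr do rewrite -mulrA.
    rewrite -mulr_sumr; congr (_ * _).
    rewrite -(sum_push g p2' (fun b => F (f a, b))).
    by apply: eq_bigr => b _; rewrite -push_comp.
  rewrite -(sum_push f p1' (fun a => \sum_b r2 b * F (a, b))).
  rewrite -[leRHS](_ : \sum_t r t = 1); last by rewrite /r sum_push1.
  rewrite -(pair_bigA _ (fun a b => r (a, b)))/=.
  apply: ler_sum => a _; rewrite -push_comp -/r1 mulr_sumr.
  apply: ler_sum => b _; rewrite /F/=.
  (* Where a marginal vanishes the left side is 0, and an inequality is all that is asked. *)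
  have [->|h1] := eqVneq (r1 a) 0; first by rewrite mul0r.
  have [->|h2] := eqVneq (r2 b) 0; first by rewrite mul0r mulr0.
  by rewrite le_eqVlt; apply/orP; left; apply/eqP; field; apply/andP.
have := gibbs p0 q0 qp q1.
rewrite [X in _ <= X](_ : _ = ent r + (ent p1' - ent r1) + (ent p2' - ent r2)).
  lra.
have H (S : finType) (h : _ -> S) :
    ent (push h p) = \sum_t - (p t * log2 (push h p (h t))).
  rewrite /ent; under eq_bigr do rewrite etaHE -mulrN.
  rewrite (sum_push h p (fun s => - log2 (push h p s))).
  by apply: eq_bigr => t _; rewrite mulrN.
rewrite !H -!sumrB -!big_split/=; apply: eq_bigr => t _.
have [->|pN0] := eqVneq (p t) 0; first by rewrite !mul0r; ring.
have pt : 0 < p t by rewrite lt_neqAle eq_sym pN0 p0.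
have [h1 h2 h3 h4 h5] := pos _ pt.
rewrite /q /F !log2M ?log2V ?invr_gt0 ?mulr_gt0//=.
by rewrite log2M// -/r -/p1' -/p2' -/r1 -/r2; ring.
by rewrite invr_gt0 mulr_gt0.
Qed.

(** * Measurability on the full shift *)

Definition agree (N : nat) (x y : fullshift) : Prop :=
  forall i : int, (`|i| <= N)%N -> x i = y i.

(** These are the finite unions of cylinders, that is, the clopen sets. Stating this through [agree]
    makes stability under intersections and shifts immediate. *)
Definition finitary (A : set fullshift) : Prop :=
  exists N, forall x y, agree N x y -> A x -> A y.

Lemma agree_sym N x y : agree N x y -> agree N y x.
Proof. by move=> xy i iN; rewrite xy. Qed.

Lemma agree_trans N x y z : agree N x y -> agree N y z -> agree N x z.
Proof. by move=> xy yz i iN; rewrite xy// yz. Qed.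

Lemma agree_le N M x y : (N <= M)%N -> agree M x y -> agree N x y.
Proof. by move=> NM xy i iN; rewrite xy// (leq_trans iN). Qed.

Definition window (N : nat) (x : fullshift) : {ffun 'I_(N.*2.+1) -> bool} :=
  [ffun i : 'I_(N.*2.+1) => x (i%:Z - N%:Z)].

Lemma windowP N x y : window N x = window N y -> agree N x y.
Proof.
move=> /ffunP xy i iN.
have [j ji] : exists j : 'I_(N.*2.+1), j%:Z - N%:Z = i.
  have h : (absz (i + N%:Z)%R < N.*2.+1)%N.
    by rewrite -ltz_nat; move: iN; rewrite -lez_nat; lia.
  by exists (Ordinal h) => /=; move: iN; rewrite -lez_nat; lia.
by have := xy j; rewrite !ffunE ji.
Qed.

Lemma finitaryI A C : finitary A -> finitary C -> finitary (A `&` C).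
Proof.
move=> [N hA] [M hC]; exists (maxn N M) => x y xy [Ax Cx]; split.
  by apply: hA Ax; apply: agree_le xy; exact: leq_maxl.
by apply: hC Cx; apply: agree_le xy; exact: leq_maxr.
Qed.

(** Otherwise choose for each N a point outside [U] agreeing with [x] up to N; these points converge
    to [x] coordinatewise, so they enter [U]. *)
Lemma open_agree (U : set fullshift_top) x : open U -> U x ->
  exists N, forall y, agree N x y -> U y.
Proof.
move=> oU Ux; apply: contrapT => /forallNP h.
have {}h N : exists y, agree N x y /\ ~ U y.
  by have /existsNP[y /not_implyP ?] := h N; exists y.
have [y hy] := choice h.
have : (y n : fullshift_top) @[n --> \oo] --> (x : fullshift_top).
  apply/cvg_sup => i A; rewrite nbhsE => -[B [[C oC <-] Cx] BA].
  change (\forall n \near \oo, A (y n)).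
  near=> n; apply: BA; rewrite /=.
  suff <- : x i = y n i by [].
  apply: (proj1 (hy n)).
  by near: n; exact: nbhs_infty_ge.
have Ux' : nbhs (x : fullshift_top) U by exact: open_nbhs_nbhs.
move=> /(_ _ Ux') [N _ /(_ N (leqnn N))].
exact: (proj2 (hy N)).
Unshelve. all: end_near. Qed.

(** [F N] consists of the points whose whole central cylinder of radius N lies in [U]. This links
    the Borel sets to the finitary ones. *)
Lemma open_bigcup_finitary (U : set fullshift_top) : open U ->
  exists F : nat -> set fullshift,
    (forall N, finitary (F N)) /\ U = \bigcup_N F N.
Proof.
move=> oU; exists (fun N => [set x | forall y, agree N x y -> U y]); split.
  move=> N; exists N => x y xy h z yz; apply: h; exact: agree_trans xy yz.
rewrite eqEsubset; split => [x Ux|x [N _]].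
  by have [N h] := open_agree oU Ux; exists N.
by apply => i.
Qed.

(** Measurability is stated on fibres, so that the finite target needs no sigma-algebra of its
    own. *)
Definition fmeas d (Omega : measurableType d) (S : finType) (f : Omega -> S) :=
  forall s, measurable (f @^-1` [set s]).

Lemma preimage_bigcup_fiber (Omega : Type) (S : finType) (f : Omega -> S)
  (A : set S) : f @^-1` A = \bigcup_(s in A) f @^-1` [set s].
Proof.
by rewrite eqEsubset; split => [x Ax|x [s As /= ->]//]; exists (f x).
Qed.

Lemma fmeas_preimage d (Omega : measurableType d) (S : finType)
  (f : Omega -> S) (A : set S) : fmeas f -> measurable (f @^-1` A).
Proof.
move=> mf; rewrite preimage_bigcup_fiber.
by apply: fin_bigcup_measurable => // s _; exact: mf.
Qed.

Lemma fmeas_comp d (Omega : measurableType d) (S T : finType)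
  (f : Omega -> S) (h : S -> T) : fmeas f -> fmeas (h \o f).
Proof. by move=> mf t; rewrite comp_preimage; exact: fmeas_preimage. Qed.

Lemma fmeas_pair d (Omega : measurableType d) (S T : finType)
  (f : Omega -> S) (g : Omega -> T) :
  fmeas f -> fmeas g -> fmeas (fun x => (f x, g x)).
Proof.
move=> mf mg [s t]; rewrite (_ : _ @^-1` _ =
    f @^-1` [set s] `&` g @^-1` [set t]); first exact: measurableI.
by rewrite eqEsubset; split => x /= [-> ->].
Qed.

Lemma fmeas_ffun d (Omega : measurableType d) (I S : finType)
  (f : I -> Omega -> S) : (forall i, fmeas (f i)) ->
  fmeas (fun x => [ffun i => f i x]).
Proof.
move=> mf s; rewrite (_ : _ @^-1` _ = \bigcap_(i in [set: I])
  f i @^-1` [set s i]).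
  by apply: fin_bigcap_measurable => // i _; exact: mf.
rewrite eqEsubset; split => [x /= <- i _ /=|x h /=]; first by rewrite ffunE.
by apply/ffunP => i; rewrite ffunE; exact: h.
Qed.

Lemma measurable_preimage_finitary d (Omega : measurableType d)
  (f : Omega -> fullshift) (A : set fullshift) :
  (forall i : int, fmeas (fun x => f x i)) -> finitary A ->
  measurable (f @^-1` A).
Proof.
move=> mf [N hA].
rewrite (_ : f @^-1` A = (fun x => window N (f x)) @^-1` (window N @` A)).
  apply: fmeas_preimage; apply: (@fmeas_ffun _ _ _ _
    (fun (i : 'I_(N.*2.+1)) x => f x (i%:Z - N%:Z))) => i.
  exact: mf.
rewrite eqEsubset; split => [x Ax|x /= [y Ay /windowP xy]]; first by exists (f x).
exact: hA Ay.
Qed.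

(** Open sets generate the Borel sets and are countable unions of finitary sets, whose preimages
    involve finitely many coordinates. *)
Lemma measurable_to_fullshift d (Omega : measurableType d)
  (f : Omega -> fullshift) : (forall i : int, fmeas (fun x => f x i)) ->
  measurable_fun setT f.
Proof.
move=> mf; apply: (@measurability _ _ _ fullshift _ _ (@open fullshift_top)) => //.
move=> _ [U oU <-]; rewrite setTI.
have [F [finF ->]] := open_bigcup_finitary oU.
rewrite preimage_bigcup; apply: bigcupT_measurable => N.
exact: measurable_preimage_finitary.
Qed.

Lemma measurable_coord (i : int) : fmeas (fun x : fullshift => x i).
Proof.
move=> s; apply: sub_sigma_algebra.
apply: (@open_comp fullshift_top bool (@proj int (fun=> bool) i)).
  by move=> x _; exact: (@proj_continuous int (fun=> bool)).
exact: discrete_open.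
Qed.

Lemma measurable_finitary (A : set fullshift) : finitary A -> measurable A.
Proof.
move=> fA; rewrite -[A]preimage_id.
by apply: measurable_preimage_finitary => // i; exact: measurable_coord.
Qed.

Lemma measurable_closed (A : set fullshift_top) :
  closed A -> measurable (A : set fullshift).
Proof.
move=> cA; rewrite -[A]setCK; apply: measurableC; apply: sub_sigma_algebra.
exact: closed_openC.
Qed.

Lemma measurable_shift : measurable_fun setT Defs.shift.
Proof. by apply: measurable_to_fullshift => i; exact: measurable_coord. Qed.

Lemma measurable_mulM : measurable_fun setT mulM.
Proof.
apply: measurable_to_fullshift => i.
have m1 : fmeas (fun p : fullshift * fullshift => p.1 i).
  move=> s; have := @measurable_fst _ _ fullshift fullshift measurableT
    _ (@measurable_coord i s).
  by rewrite setTI.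
have m2 : fmeas (fun p : fullshift * fullshift => p.2 i).
  move=> s; have := @measurable_snd _ _ fullshift fullshift measurableT
    _ (@measurable_coord i s).
  by rewrite setTI.
exact: (fmeas_comp (fun b : bool * bool => b.1 && b.2) (fmeas_pair m1 m2)).
Qed.

Lemma measurable_preimage d d' (Omega : measurableType d)
  (Omega' : measurableType d') (f : Omega -> Omega') A :
  measurable_fun setT f -> measurable A -> measurable (f @^-1` A).
Proof. by move=> mf mA; rewrite -[X in measurable X]setTI; exact: mf. Qed.

(** The finitary sets form a pi-system that generates the Borel sigma-algebra. *)
Lemma eq_probability_finitary (R : realType)
  (m1 m2 : {measure set fullshift -> \bar R}) : m1 setT = 1%E -> m2 setT = 1%E ->
  (forall A, finitary A -> m1 A = m2 A) ->
  forall A, measurable A -> m1 A = m2 A.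
Proof.
move=> p1 p2 m12 A mA.
apply: (g_sigma_algebra_measure_unique finitary _ (fun=> setT)) => //.
- by move=> C; exact: measurable_finitary.
- by move=> i; exists 0%N.
- by rewrite bigcup_const.
- by move=> C D; exact: finitaryI.
- by move=> _; rewrite /= p1 ltry.
- suff h : (@open fullshift_top) `<=` <<s finitary >>.
    exact: (smallest_sub (smallest_sigma_algebra _ _) h).
  move=> U oU; have [F [finF ->]] := open_bigcup_finitary oU.
  apply: sigma_algebra_bigcup => N.
  exact: sub_sigma_algebra.
Qed.

(** * Laws of finite-valued maps *)

Definition law {R : realType} d (Omega : measurableType d)
  (P : set Omega -> \bar R) (S : finType) (f : Omega -> S) (s : S) : R :=
  fine (P (f @^-1` [set s])).

Lemma fine_prob_preimage (R : realType) d (Omega : measurableType d)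
  (P : probability Omega R) (S : finType) (f : Omega -> S) (A : pred S) :
  fmeas f -> fine (P (f @^-1` [set s | A s])) = \sum_(s | A s) law P f s.
Proof.
move=> mf; rewrite preimage_bigcup_fiber measure_fin_bigcup//; first last.
- by move=> s t _ _ [x [/= <- <-]].
- exact: finite_finset.
rewrite (fsbigE [seq s <- index_enum S | A s])//; first last.
- by move=> s /= As; rewrite mem_filter As mem_index_enum.
- by move=> s; rewrite /= mem_filter => /andP[].
- by rewrite filter_uniq// index_enum_uniq.
rewrite -sum_fine => [|s _]; last by apply: fin_num_measure; exact: mf.
rewrite big_filter_cond; apply: eq_bigl => s.
by rewrite andb_idr// => As; rewrite inE.
Qed.

Lemma law_push (R : realType) d (Omega : measurableType d)
  (P : probability Omega R) (S T : finType) (f : Omega -> S) (h : S -> T) :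
  fmeas f -> law P (h \o f) =1 push h (law P f).
Proof.
move=> mf t; rewrite /push -fine_prob_preimage//; congr (fine (P _)).
by rewrite eqEsubset; split => x /= /eqP.
Qed.

Lemma law_ge0 (R : realType) d (Omega : measurableType d)
  (P : probability Omega R) (S : finType) (f : Omega -> S) s : 0 <= law P f s.
Proof. by rewrite fine_ge0. Qed.

Lemma sum_law (R : realType) d (Omega : measurableType d)
  (P : probability Omega R) (S : finType) (f : Omega -> S) :
  fmeas f -> \sum_s law P f s = 1.
Proof.
move=> mf; rewrite -(fine_prob_preimage P xpredT mf).
by rewrite (_ : _ @^-1` _ = setT) ?probability_setT// eqEsubset.
Qed.

Lemma ent_law_cst (R : realType) d (Omega : measurableType d)
  (P : probability Omega R) (S : finType) (c : S) :
  ent (law P (fun=> c)) = 0.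
Proof.
apply: big1 => s _; rewrite /law etaHE.
have [<-|cs] := eqVneq c s.
  by rewrite (_ : _ @^-1` _ = setT) ?probability_setT/= ?log2_1 ?mulr0 ?oppr0//
    eqEsubset.
rewrite (_ : _ @^-1` _ = set0) ?measure0 ?mul0r ?oppr0// eqEsubset.
by split => // x /= /eqP; exact/negP.
Qed.

(** * Measures from finitely additive functions *)

(** Normalising is the identity at mass 1 and supplies the bundled structure; the Dirac mass is the
    default of [mnormalize] for degenerate masses. *)
Lemma probability_of_measure (R : realType) d (T : measurableType d)
  (m : {measure set T -> \bar R}) : m setT = 1%E ->
  exists P : probability T R, forall A, P A = m A.
Proof.
move=> m1; exists (mnormalize m (dirac point)) => A.
by rewrite /= /mnormalize m1 /= onee_eq0 /= invr1 mule1.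
Qed.

Lemma probability_pushforward (R : realType) d d' (T : measurableType d)
  (T' : measurableType d') (P : probability T R) (f : T -> T') :
  measurable_fun setT f ->
  exists Q : probability T' R, forall A, Q A = P (f @^-1` A).
Proof.
move=> mf; pose X : {mfun T >-> T'} := mfun_Sub (mem_set mf).
by exists (distribution P X).
Qed.

(** A finitely additive probability on all subsets, the form in which limits along an ultrafilter
    arise. *)
Definition fadditive {R : realType} {T : Type} (L : set T -> R) : Prop :=
  [/\ forall A, 0 <= L A, L setT = 1 &
      forall A C, A `&` C = set0 -> L (A `|` C) = L A + L C].

Lemma fadditive0 (R : realType) (T : Type) (L : set T -> R) :
  fadditive L -> L set0 = 0.
Proof.
move=> [_ _ /(_ set0 set0)]; rewrite setU0 setI0 => /(_ erefl) h.
by apply: (@addrI _ (L set0)); rewrite -h addr0.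
Qed.

Lemma fadditive_preimage (R : realType) (T : Type) (S : finType)
  (L : set T -> R) (f : T -> S) (A : pred S) : fadditive L ->
  L (f @^-1` [set s | A s]) = \sum_(s | A s) L (f @^-1` [set s]).
Proof.
move=> fL; rewrite -big_filter.
rewrite (_ : [set s | A s] = [set` [seq s <- index_enum S | A s]]); last first.
  by rewrite eqEsubset; split => s; rewrite /= mem_filter mem_index_enum andbT.
have : uniq [seq s <- index_enum S | A s].
  by rewrite filter_uniq// index_enum_uniq.
elim: [seq _ <- _ | _] => [_|s r IH /= /andP[sr ur]].
  rewrite big_nil -(fadditive0 fL); congr L.
  by rewrite eqEsubset; split => // x.
rewrite big_cons -IH//; case: fL => _ _ <-; last first.
  by rewrite eqEsubset; split => x //= [-> ]; exact/negP.
congr L; rewrite eqEsubset; split => x /=.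
  by rewrite inE => /orP[/eqP|]; [left|right].
by rewrite inE; case=> [->|->]; rewrite ?eqxx// orbT.
Qed.

(** [pickle] enumerates the integers, turning a point into a one-sided sequence; an index that codes
    no integer carries the constant bit [false]. *)
Definition coord (k : nat) (x : fullshift) : bool :=
  if unpickle k is Some i then x i else false.

Definition pcyl (w : seq bool) : set fullshift :=
  [set x | mkseq (coord^~ x) (size w) = w].

Lemma mkseq_rcons (T : Type) (f : nat -> T) n :
  mkseq f n.+1 = rcons (mkseq f n) (f n).
Proof. by rewrite /mkseq -addn1 iotaD map_cat cats1. Qed.

Lemma pcyl_rcons w b : pcyl (rcons w b) = pcyl w `&` [set x | coord (size w) x = b].
Proof.
rewrite eqEsubset /pcyl; split => x /=; rewrite size_rcons mkseq_rcons.
  by move/rcons_inj => [].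
by move=> [-> ->].
Qed.

(* Left end of the interval coded by [w] in the inverse-distribution-function
   coding: the intervals of the words of a given length are consecutive in
   lexicographic order, the interval of [w] having length [q w]. *)
Definition lend {R : realType} (q : seq bool -> R) (w : seq bool) : R :=
  \sum_(i < size w) if nth false w i then q (rcons (take i w) false) else 0.

(** The inverse distribution function read bit by bit: the interval of the current word is cut in
    two, and the next bit tells on which side [t] falls. *)
Fixpoint code {R : realType} (q : seq bool -> R) (t : R) (k : nat) : seq bool :=
  if k is k'.+1 then
    let w := code q t k' in rcons w (lend q w + q (rcons w false) <= t)
  else [::].

Lemma lend_rcons (R : realType) (q : seq bool -> R) w b :
  lend q (rcons w b) = lend q w + if b then q (rcons w false) else 0.
Proof.
rewrite /lend size_rcons big_ord_recr/= nth_rcons ltnn eqxx; congr (_ + _).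
  apply: eq_bigr => i _; rewrite nth_rcons ltn_ord.
  by rewrite -[in take _ (rcons w b)]cats1 takel_cat// ltnW.
by rewrite -[in take _ (rcons w b)]cats1 takel_cat// take_size.
Qed.

Lemma size_code (R : realType) (q : seq bool -> R) t k : size (code q t k) = k.
Proof. by elim: k => //= k IH; rewrite size_rcons IH. Qed.

Lemma nth_code (R : realType) (q : seq bool -> R) t k K : (k < K)%N ->
  nth false (code q t K) k = nth false (code q t k.+1) k.
Proof.
elim: K => // K IH; rewrite ltnS leq_eqVlt => /orP[/eqP->//|kK].
by rewrite -IH//= nth_rcons size_code kK.
Qed.

(** Induction on the last letter: by additivity of [q] the intervals of the two extensions of a word
    partition its own interval. *)
Lemma codeP (R : realType) (q : seq bool -> R) (t : R) w :
  (forall w, 0 <= q w) -> q [::] = 1 ->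
  (forall w, q w = q (rcons w false) + q (rcons w true)) ->
  0 <= t < 1 -> code q t (size w) = w <-> lend q w <= t < lend q w + q w.
Proof.
move=> q0 q1 qD t01; elim/last_ind: w => [|w b IH].
  by rewrite /lend big_ord0 q1 add0r t01.
rewrite size_rcons/= lend_rcons; split.
  move=> /rcons_inj[hw hb]; move: hb; rewrite hw => hb.
  have /andP[h1 h2] := (iffLR IH) hw; rewrite (qD w) in h2.
  by case: b hb => [hb|/negbT]; [|rewrite -ltNge => hb]; rewrite ?addr0; lra.
move=> h; have hw : code q t (size w) = w.
  apply/IH; move: h; rewrite (qD w); have := q0 (rcons w false).
  have := q0 (rcons w true).
  by case: b => *; rewrite ?addr0; lra.
rewrite hw; congr rcons; case: b h => [/andP[->]//|].
by rewrite addr0 => /andP[_ h]; apply/negbTE; rewrite -ltNge.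
Qed.

Lemma lend_bounds (R : realType) (q : seq bool -> R) w :
  (forall w, 0 <= q w) -> q [::] = 1 ->
  (forall w, q w = q (rcons w false) + q (rcons w true)) ->
  0 <= lend q w /\ lend q w + q w <= 1.
Proof.
move=> q0 q1 qD; elim/last_ind: w => [|w b [IH1 IH2]].
  by rewrite /lend big_ord0 q1 add0r.
rewrite lend_rcons; have := q0 (rcons w false); have := q0 (rcons w true).
by move: IH2; rewrite (qD w); case: b => *; split; lra.
Qed.

Lemma measurable_code (R : realType) (q : seq bool -> R) k w :
  measurable [set t : R | code q t k = w].
Proof.
elim: k w => [|k IH] w /=.
  case: w => [|b w]; first by rewrite (_ : [set _ | _] = setT)// eqEsubset.
  by rewrite (_ : [set _ | _] = set0)// eqEsubset; split.
case/lastP: w => [|w b].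
  rewrite (_ : [set _ | _] = set0)// eqEsubset; split => // t /= /(congr1 size).
  by rewrite size_rcons.
set c := lend q w + q (rcons w false).
rewrite (_ : [set _ | _] = [set t | code q t k = w] `&`
    [set t | (c <= t) = b]); last first.
  rewrite eqEsubset; split => t /=; first by move=> /rcons_inj[-> <-].
  by move=> [-> <-].
apply: measurableI; first exact: IH.
case: b.
  rewrite (_ : [set t | _] = `[c, +oo[%classic); first exact: measurable_itv.
  by rewrite eqEsubset; split => t /=; rewrite in_itv/= andbT.
rewrite (_ : [set t | _] = `]-oo, c[%classic); first exact: measurable_itv.
rewrite eqEsubset; split => t /=; rewrite in_itv/= ltNge.
  by move=> ->.
by move/negbTE.
Qed.

Definition decode (w : seq bool) : fullshift := fun i => nth false w (pickle i).

Lemma agree_decode N K x w :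
  (forall i : int, (`|i| <= N)%N -> (pickle i < K)%N) ->
  (forall k, (k < K)%N -> nth false w k = coord k x) -> agree N x (decode w).
Proof.
move=> NK wx i iN; rewrite /decode wx ?NK// /coord pickleK.
by [].
Qed.

Lemma pickle_bound N : exists K, forall i : int, (`|i| <= N)%N -> (pickle i < K)%N.
Proof.
exists (\max_(j < N.*2.+1) pickle (j%:Z - N%:Z)%R).+1 => i iN.
have h : (absz (i + N%:Z)%R < N.*2.+1)%N.
  by rewrite -ltz_nat; move: iN; rewrite -lez_nat; lia.
rewrite ltnS; have := @leq_bigmax _ (fun j : 'I_(N.*2.+1) =>
  pickle (j%:Z - N%:Z)%R) (Ordinal h).
by rewrite /= (_ : _ - _ = i)//; move: iN; rewrite -lez_nat; lia.
Qed.

(** Lebesgue measure on [0, 1) is pushed forward by the coding, which gives each initial cylinder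
    its [L]-mass; countable additivity is inherited from Lebesgue measure. *)
Lemma fadditive_extension (R : realType) (L : set fullshift -> R) :
  fadditive L ->
  exists P : probability fullshift R, forall A, finitary A -> P A = (L A)%:E.
Proof.
move=> fL; have [L0 L1 LD] := fL.
pose q w := L (pcyl w).
have q0 w : 0 <= q w by exact: L0.
have q1 : q [::] = 1.
  by rewrite /q (_ : pcyl [::] = setT)// eqEsubset.
have qD w : q w = q (rcons w false) + q (rcons w true).
  rewrite /q -LD; last first.
    by rewrite !pcyl_rcons eqEsubset; split => // x [[_ /= ->] []].
  congr L; rewrite !pcyl_rcons -setIUr (_ : _ `|` _ = setT) ?setIT//.
  by rewrite eqEsubset; split => // x _ /=; case: (coord _ x); [right|left].
pose D : set R := `[0%R, 1%R[%classic.
have mD : measurable D by exact: measurable_itv.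
have [U hU] : exists U : probability (measurableTypeR R) R,
    forall A, U A = lebesgue_measure (A `&` D).
  apply: (@probability_of_measure _ _ _ (mrestr lebesgue_measure mD)).
  rewrite [LHS](_ : _ = lebesgue_measure D); last by congr lebesgue_measure; exact: setTI.
  by rewrite lebesgue_measure_itv/= lte_fin ltr01 sube0.
have Uq w : U [set t | code q t (size w) = w] = (q w)%:E.
  rewrite hU (_ : _ `&` D = `[lend q w, lend q w + q w[%classic).
    (* The interval is empty exactly when [q w = 0]. *)
    rewrite lebesgue_measure_itv/= lte_fin ltrDl; case: ltP => [_|qw].
      by rewrite -EFinB addrAC subrr add0r.
    by rewrite (_ : q w = 0)//; apply/eqP; rewrite eq_le qw q0.
  have [l0 l1] := lend_bounds w q0 q1 qD.
  rewrite eqEsubset /D; split => t /=; rewrite !in_itv/=.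
    by move=> [h t01]; exact: (iffLR (codeP w q0 q1 qD t01)) h.
  move=> h; have t01 : 0 <= t < 1 by lra.
  by split => //; exact: (iffRL (codeP w q0 q1 qD t01)) h.
(* Coordinate i is read from a code just long enough to contain index [pickle i]; [nth_code] shows
   that longer codes give the same bit. *)
pose phi (t : R) : fullshift := fun i => nth false (code q t (pickle i).+1) (pickle i).
pose codeK K t : K.-tuple bool := Tuple (introT eqP (size_code q t K)).
have mcode K : @fmeas _ (measurableTypeR R) _ (codeK K).
  move=> w; have := measurable_code q K w.
  rewrite (_ : [set t | _] = codeK K @^-1` [set w])// eqEsubset; split => t /=.
    by move=> h; exact: val_inj.
  by move=> <-.
have mphi : measurable_fun setT phi.
  apply: measurable_to_fullshift => i.
  exact: (fmeas_comp (fun w : (pickle i).+1.-tuple bool => nth false w (pickle i))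
    (mcode (pickle i).+1)).
have [P hP] := probability_pushforward U mphi.
exists P => A [N hA]; rewrite hP.
have [K hK] := pickle_bound N.
(* Since [A] depends on the first [K] indices only, both [A] and its preimage under [phi] are
   described by the same finite set of words. *)
pose B := [pred w : K.-tuple bool | `[< A (decode w) >]].
have -> : phi @^-1` A = codeK K @^-1` [set w | B w].
  rewrite eqEsubset; split => t /= h.
    apply/asboolP; apply: hA h => i iN; rewrite /decode /phi/=.
    by rewrite -(@nth_code _ _ _ _ K) ?hK.
  move/asboolP : h; apply: hA => i iN; rewrite /decode /phi/=.
  by rewrite -(@nth_code _ _ _ _ K) ?hK.
pose f x : K.-tuple bool := [tuple of mkseq (coord^~ x) K].
have -> : A = f @^-1` [set w | B w].
  have xf x : agree N x (decode (f x)).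
    apply: agree_decode hK _ => k kK.
    by rewrite /f/= nth_mkseq.
  rewrite eqEsubset; split => x h /=; first by apply/asboolP; exact: hA h.
  by move/asboolP : h; apply: hA; exact: agree_sym.
rewrite fadditive_preimage// -[LHS]fineK; last first.
  by apply: fin_num_measure; exact: (fmeas_preimage [set w | B w] (mcode K)).
rewrite (fine_prob_preimage U B (mcode K)); congr EFin; apply: eq_bigr => w _.
rewrite /law (_ : codeK K @^-1` [set w] = [set t | code q t (size w) = w]).
  rewrite Uq /= /q /pcyl; congr L.
  rewrite eqEsubset size_tuple; split => x /=; first by move=> h; exact: val_inj.
  by move=> <-.
rewrite eqEsubset size_tuple; split => t /=; first by move=> <-.
by move=> h; exact: val_inj.
Qed.

(** * Block entropy of joinings *)

Lemma fmeas_tuple d (Omega : measurableType d) n (S : finType)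
  (f : 'I_n -> Omega -> S) : (forall i, fmeas (f i)) ->
  fmeas (fun x => [tuple f i x | i < n]).
Proof.
move=> mf.
have := fmeas_comp (fun g : {ffun 'I_n -> S} => [tuple g i | i < n]) (fmeas_ffun mf).
congr fmeas; apply/funext => x /=; apply: eq_from_tnth => i.
by rewrite !tnth_mktuple ffunE.
Qed.

Definition word n (x : fullshift) : n.-tuple bool := [tuple x i%:Z | i < n].

Lemma fmeas_word n : fmeas (word n).
Proof. by apply: fmeas_tuple => i; exact: measurable_coord. Qed.

Lemma cylE n (w : n.-tuple bool) : cyl w = @word n @^-1` [set w].
Proof.
rewrite eqEsubset; split => x /= xw; last by move=> i; rewrite -xw tnth_mktuple.
by apply: eq_from_tnth => i; rewrite tnth_mktuple.
Qed.

Lemma HnE (R : realType) (mu : set fullshift -> \bar R) n :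
  Hn mu n = ent (law mu (@word n)).
Proof. by apply: eq_bigr => w _; rewrite cylE. Qed.

Lemma iter_shiftE n (x : fullshift) (i : int) :
  iter n Defs.shift x i = x (i + n%:Z).
Proof.
elim: n i => [|n IH] i /=; first by rewrite addr0.
by rewrite /Defs.shift IH; congr x; lia.
Qed.

Definition tcat n m (S : Type) (w : n.-tuple S * m.-tuple S) :
  (n + m).-tuple S := [tuple of w.1 ++ w.2].

Lemma word_cat n m x :
  word (n + m) x = tcat (word n x, word m (iter n Defs.shift x)).
Proof.
apply: eq_from_tnth => i; rewrite tnth_mktuple -[i]splitK.
case: (fintype.split i) => j /=.
  by rewrite tnth_lshift tnth_mktuple.
by rewrite tnth_rshift tnth_mktuple iter_shiftE /= PoszD addrC.
Qed.

Definition tsplit n m (S : Type) (w : (n + m).-tuple S) :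
  n.-tuple S * m.-tuple S :=
  ([tuple tnth w (lshift m i) | i < n], [tuple tnth w (rshift n i) | i < m]).

Lemma tsplit_cat n m (S : Type) (u : n.-tuple S) (v : m.-tuple S) :
  tsplit (tcat (u, v)) = (u, v).
Proof.
by congr pair; apply: eq_from_tnth => i;
  rewrite tnth_mktuple ?tnth_lshift ?tnth_rshift.
Qed.

Lemma law_iter (R : realType) d (Omega : measurableType d)
  (P : probability Omega R) (T : Omega -> Omega) (S : finType) (f : Omega -> S)
  n : measurable_fun setT T ->
  (forall A, measurable A -> P (T @^-1` A) = P A) -> fmeas f ->
  fmeas (f \o iter n T) /\ law P (f \o iter n T) =1 law P f.
Proof.
move=> mT invT mf; elim: n => // n [IH1 IH2].
have E s : (f \o iter n.+1 T) @^-1` [set s] = T @^-1` ((f \o iter n T) @^-1` [set s]).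
  by rewrite eqEsubset; split => x; rewrite /= -iterSr.
split => s; rewrite /law E.
  by apply: measurable_preimage => //; exact: IH1.
by rewrite invT; [exact: IH2|exact: IH1].
Qed.

Lemma ent_law_comp_le (R : realType) d (Omega : measurableType d)
  (P : probability Omega R) (S T : finType) (f : Omega -> S) (h : S -> T) :
  fmeas f -> ent (law P (h \o f)) <= ent (law P f).
Proof.
move=> mf; rewrite (eq_ent (law_push P h mf)).
by apply: ent_push_le => s; exact: law_ge0.
Qed.

(** With conditional entropies: H(u, v | f u, g v) <= H(u | f u) + H(v | g v). *)
Lemma ent_law_cond_subadd (R : realType) d (Omega : measurableType d)
  (P : probability Omega R) (A B A' B' : finType) (u : Omega -> A)
  (v : Omega -> B) (f : A -> A') (g : B -> B') : fmeas u -> fmeas v ->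
  ent (law P (fun x => (u x, v x))) - ent (law P (fun x => (f (u x), g (v x))))
  <= (ent (law P u) - ent (law P (f \o u))) +
     (ent (law P v) - ent (law P (g \o v))).
Proof.
move=> mu mv; have muv := fmeas_pair mu mv.
have := @ent_cond_subadd _ _ _ _ _ f g (law P (fun x => (u x, v x)))
  (law_ge0 P _) (sum_law P muv).
by rewrite -!(eq_ent (law_push P _ muv)).
Qed.

(** The preceding bound, conditioned on constant maps. *)
Lemma ent_law_pair_le (R : realType) d (Omega : measurableType d)
  (P : probability Omega R) (A B : finType) (u : Omega -> A)
  (v : Omega -> B) : fmeas u -> fmeas v ->
  ent (law P (fun x => (u x, v x))) <= ent (law P u) + ent (law P v).
Proof.
move=> mu mv.
have := @ent_law_cond_subadd _ _ _ P _ _ _ _ u v (fun=> tt) (fun=> tt) mu mv.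
by rewrite !ent_law_cst !subr0.
Qed.

Lemma Hn_ge0 (R : realType) (mu : probability fullshift R) n : 0 <= Hn mu n.
Proof.
apply: sumr_ge0 => w _; apply: etaH_ge0; rewrite fine_ge0//=.
rewrite -lee_fin fineK ?cylE; last by apply: fin_num_measure; exact: fmeas_word.
by apply: probability_le1; exact: fmeas_word.
Qed.

Lemma Hn_subadd (R : realType) (mu : probability fullshift R) n m :
  invariant_on setT mu -> Hn mu (n + m) <= Hn mu n + Hn mu m.
Proof.
move=> [_ inv]; rewrite !HnE.
have [mw lw] := law_iter n measurable_shift inv (@fmeas_word m).
rewrite -(eq_ent lw) (le_trans _ (ent_law_pair_le _ _ mw))//; last exact: fmeas_word.
rewrite (_ : @word (n + m) = @tcat n m bool \o
  (fun x => (word n x, word m (iter n Defs.shift x)))).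
  by apply: ent_law_comp_le; apply: fmeas_pair => //; exact: fmeas_word.
by apply/funext => x; rewrite word_cat.
Qed.

(** * Conditional entropy of a joining given its first coordinate *)

Definition xword n (p : fullshift * fullshift) := word n p.1.

Definition jword n (p : fullshift * fullshift) := (word n p.1, word n (mulM p)).

(** The conditional entropy of the word of z = x y given the word of x, as a difference of joint
    entropies. *)
Definition cent {R : realType} (lam : probability (fullshift * fullshift)%type R)
  (n : nat) : R := ent (law lam (@jword n)) - ent (law lam (@xword n)).

Lemma fmeas_precomp d d' (Omega : measurableType d) (Omega' : measurableType d')
  (S : finType) (g : Omega -> Omega') (f : Omega' -> S) :
  measurable_fun setT g -> fmeas f -> fmeas (f \o g).
Proof. by move=> mg mf s; rewrite comp_preimage; exact: measurable_preimage. Qed.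

Lemma fmeas_xword n : fmeas (@xword n).
Proof. by apply: (fmeas_precomp (@measurable_fst _ _ _ _) (@fmeas_word n)). Qed.

Lemma fmeas_zword n : fmeas (@word n \o mulM).
Proof. by apply: (fmeas_precomp measurable_mulM (@fmeas_word n)). Qed.

Lemma fmeas_jword n : fmeas (@jword n).
Proof. exact: (fmeas_pair (@fmeas_xword n) (@fmeas_zword n)). Qed.

Lemma measurable_shift2 : measurable_fun setT shift2.
Proof.
apply: measurable_fun_pair.
  exact: (measurableT_comp measurable_shift (@measurable_fst _ _ _ _)).
exact: (measurableT_comp measurable_shift (@measurable_snd _ _ _ _)).
Qed.

Lemma iter_shift2 n p :
  iter n shift2 p = (iter n Defs.shift p.1, iter n Defs.shift p.2).
Proof. by elim: n => [|n /= ->//]; case: p. Qed.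

Lemma iter_shift_mulM n p : iter n Defs.shift (mulM p) =
  mulM (iter n Defs.shift p.1, iter n Defs.shift p.2).
Proof. by apply/funext => i; rewrite iter_shiftE /mulM/= !iter_shiftE. Qed.

(** [ent_law_cond_subadd] is applied to the first n symbols and to the m following ones. The joint
    word of length n + m is a function of the two joint blocks, and the two x-blocks are functions
    of the x-word, so both terms of the difference compare in the right direction. *)
Lemma cent_subadd (R : realType)
  (lam : probability (fullshift * fullshift)%type R) n m :
  invariant2 lam -> cent lam (n + m) <= cent lam n + cent lam m.
Proof.
move=> inv.
have [mj lj] := law_iter n measurable_shift2 inv (@fmeas_jword m).
have [mx lx] := law_iter n measurable_shift2 inv (@fmeas_xword m).
have mjn := @fmeas_jword n; have mxn := @fmeas_xword n.
rewrite /cent -(eq_ent lj) -(eq_ent lx).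
apply: le_trans (ent_law_cond_subadd lam fst fst mjn mj).
apply: lerB.
  rewrite (_ : @jword (n + m) =
    (fun w => (tcat (w.1.1, w.2.1), tcat (w.1.2, w.2.2))) \o
    (fun p => (jword n p, (@jword m \o iter n shift2) p))).
    by apply: ent_law_comp_le; exact: fmeas_pair.
  by apply/funext => p; rewrite /= /jword !word_cat iter_shift2 iter_shift_mulM.
rewrite (_ : (fun p => _) = (@tsplit n m bool) \o @xword (n + m)).
  by apply: ent_law_comp_le; exact: fmeas_xword.
by apply/funext => p; rewrite /= /xword word_cat tsplit_cat iter_shift2.
Qed.

Lemma cent_muln (R : realType)
  (lam : probability (fullshift * fullshift)%type R) k m :
  invariant2 lam -> cent lam (k.+1 * m) <= k.+1%:R * cent lam m.
Proof.
move=> inv; elim: k => [|k IH]; first by rewrite mul1n mul1r.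
rewrite mulSn (le_trans (cent_subadd _ _ inv))//.
by rewrite -[X in _ <= X%:R * _]add1n natrD mulrDl mul1r lerD2l.
Qed.

(* Conditional law of a symbol [z = x && y] given [x], when [y] is a fair bit. *)
Definition kap {R : realType} (x z : bool) : R := if x then 2^-1 else (~~ z)%:R.

Definition kapn {R : realType} n (x z : n.-tuple bool) : R :=
  \prod_(i < n) kap (tnth x i) (tnth z i).

Lemma sum_prod_tuple (R : realType) n (F : 'I_n -> bool -> R) :
  \sum_(z : n.-tuple bool) \prod_(i < n) F i (tnth z i) =
  \prod_(i < n) \sum_b F i b.
Proof.
rewrite bigA_distr_bigA/=.
rewrite (reindex (fun f : {ffun 'I_n -> bool} => [tuple f i | i < n])).
  by apply: eq_bigr => f _; apply: eq_bigr => i _; rewrite tnth_mktuple.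
exists (fun z : n.-tuple bool => [ffun i => tnth z i]) => [f|z] _.
  by apply/ffunP => i; rewrite ffunE tnth_mktuple.
by apply: eq_from_tnth => i; rewrite tnth_mktuple ffunE.
Qed.

Lemma kapn_ge0 (R : realType) n (x z : n.-tuple bool) : 0 <= kapn x z :> R.
Proof.
by apply: prodr_ge0 => i _; rewrite /kap; case: ifP; rewrite ?invr_ge0.
Qed.

Lemma sum_kapn (R : realType) n (x : n.-tuple bool) :
  \sum_z kapn x z = 1 :> R.
Proof.
rewrite (sum_prod_tuple (fun i b => kap (tnth x i) b)) big1// => i _; rewrite big_bool/= /kap.
by case: (tnth x i) => /=; [field|rewrite add0r].
Qed.

(** Each 1 of x contributes a factor 1/2, each 0 a factor 1 unless z is 1 there, in which case the
    product vanishes. *)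
Lemma log2_kapn (R : realType) n (x z : n.-tuple bool) : kapn x z != 0 :> R ->
  - log2 (kapn x z : R) = \sum_(i < n) (tnth x i)%:R.
Proof.
move=> k0.
have -> : kapn x z = \prod_(i < n) (2 : R)^-1 ^+ tnth x i.
  apply: eq_bigr => i _; rewrite /kap; case: ifP => xi; rewrite ?expr1 ?expr0//.
  move: k0 => /prodf_neq0/(_ i isT).
  by rewrite /kap xi; case: (tnth z i); rewrite ?eqxx.
rewrite prodrXr /log2 lnXn ?invr_gt0// lnV ?posrE// mulNrn mulNr opprK.
rewrite -[ln 2 *+ _]mulr_natl mulfK; last by rewrite gt_eqF// ln2_gt0.
by rewrite natr_sum.
Qed.

(** A pair of words with positive probability is read off some point, so z lies below x and no
    factor vanishes. This is the absolute continuity needed by [gibbs]. *)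
Lemma law_jword_kapn (R : realType)
  (lam : probability (fullshift * fullshift)%type R) n x z :
  law lam (@jword n) (x, z) != 0 -> kapn x z != 0 :> R.
Proof.
move=> l0; have /set0P[p [<- <-]] : @jword n @^-1` [set (x, z)] != set0.
  by apply: contra l0 => /eqP e; rewrite /law e measure0.
apply/prodf_neq0 => i _; rewrite /kap !tnth_mktuple /mulM.
by case: (p.1 i) => //=; rewrite ?oner_eq0// invr_eq0 pnatr_eq0.
Qed.

(** The logarithm of the product splits: the first factor gives the entropy of the x-word, the
    second the expected number of its ones. *)
Lemma cross_entropy_kapn (R : realType)
  (lam : probability (fullshift * fullshift)%type R)
  (nu : probability fullshift R) n :
  invariant_on setT nu ->
  (forall A, measurable A -> pushforward lam fst A = nu A) ->
  \sum_t - (law lam (@jword n) t * log2 (law lam (@xword n) t.1 * kapn t.1 t.2))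
  = ent (law lam (@xword n)) + n%:R * one_freq nu.
Proof.
move=> [_ inv] lamnu; set p := law lam (@jword n).
have mj := @fmeas_jword n.
have xE : law lam (@xword n) =1 push fst p by move=> x; exact: (law_push lam fst mj).
have p0 t : 0 <= p t by exact: law_ge0.
rewrite (eq_bigr (fun t => p t * - log2 (push fst p t.1) +
    p t * \sum_(i < n) (tnth t.1 i)%:R)); last first.
  move=> t _; rewrite -mulrDr -mulrN.
  have [->|pN0] := eqVneq (p t) 0; first by rewrite !mul0r.
  have pt : 0 < p t by rewrite lt_neqAle eq_sym pN0 p0.
  have k0 : kapn t.1 t.2 != 0 :> R by apply: (@law_jword_kapn _ lam); case: t pN0 {pt}.
  rewrite log2M; last by rewrite lt_neqAle eq_sym k0 kapn_ge0.
    by rewrite opprD log2_kapn// xE.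
  by rewrite xE; apply: lt_le_trans (le_push _ _ _).
rewrite big_split/= -(sum_push fst p (fun x => - log2 (push fst p x))).
congr (_ + _).
  by apply: eq_bigr => x _; rewrite etaHE xE mulrN.
under eq_bigr do rewrite mulr_sumr.
rewrite exchange_big/= (eq_bigr (fun=> one_freq nu)).
  by rewrite sumr_const card_ord mulr_natl.
move=> i _.
(* By invariance of [nu] each symbol of x is 1 with probability nu(1). *)
have m0 := @measurable_coord 0.
have [mi li] := law_iter i measurable_shift inv m0.
rewrite /one_freq -[RHS](li true).
transitivity (law lam ((fun t : n.-tuple bool * n.-tuple bool => tnth t.1 i) \o
    @jword n) true).
  rewrite (law_push lam _ mj) /push [RHS]big_mkcond/=; apply: eq_bigr => t _.
  by case: (tnth t.1 i); rewrite ?mulr1 ?mulr0.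
rewrite /law -(lamnu _ (mi true)) /pushforward; congr (fine (lam _)).
rewrite eqEsubset; split => q /=; rewrite tnth_mktuple iter_shiftE add0r//.
Qed.

(** The hypotheses of [gibbs] for the reference law in which y consists of fair bits independent of
    x. *)
Lemma gibbs_kapn (R : realType)
  (lam : probability (fullshift * fullshift)%type R) n :
  let q t := law lam (@xword n) t.1 * kapn t.1 t.2 in
  [/\ forall t, 0 <= q t, forall t, q t = 0 -> law lam (@jword n) t = 0 &
      \sum_t q t <= \sum_t law lam (@jword n) t].
Proof.
have mj := @fmeas_jword n.
have xE : law lam (@xword n) =1 push fst (law lam (@jword n)).
  by move=> x; exact: (law_push lam fst mj).
split.
- by move=> t; rewrite mulr_ge0 ?law_ge0 ?kapn_ge0.
- move=> t q0; apply/eqP/negP => /negP pN0.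
  have k0 : kapn t.1 t.2 != 0 :> R by apply: (@law_jword_kapn _ lam); case: t pN0 {q0}.
  move/eqP: q0; rewrite mulf_eq0 (negbTE k0) orbF xE => /eqP/push_eq0 => h.
  by move/eqP: pN0; apply; apply: h => s; exact: law_ge0.
- rewrite (sum_law lam mj) -(pair_bigA _ (fun x z => law lam (@xword n) x * kapn x z))/=.
  under eq_bigr do rewrite -mulr_sumr sum_kapn mulr1.
  by rewrite sum_law//; exact: fmeas_xword.
Qed.

Lemma cent_le (R : realType)
  (lam : probability (fullshift * fullshift)%type R)
  (nu : probability fullshift R) n :
  invariant_on setT nu ->
  (forall A, measurable A -> pushforward lam fst A = nu A) ->
  cent lam n <= n%:R * one_freq nu.
Proof.
move=> inv lamnu; have [q0 qp q1] := gibbs_kapn lam n.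
have := gibbs (law_ge0 lam _) q0 qp q1.
by rewrite (cross_entropy_kapn n inv lamnu) /cent lerBlDl.
Qed.

Lemma cent_eq (R : realType)
  (lam : probability (fullshift * fullshift)%type R)
  (nu : probability fullshift R) n :
  invariant_on setT nu ->
  (forall A, measurable A -> pushforward lam fst A = nu A) ->
  n%:R * one_freq nu <= cent lam n ->
  forall t, law lam (@jword n) t = law lam (@xword n) t.1 * kapn t.1 t.2.
Proof.
move=> inv lamnu le; have [q0 qp q1] := gibbs_kapn lam n.
apply: (gibbs_eq (law_ge0 lam _) q0 qp q1).
by rewrite (cross_entropy_kapn n inv lamnu) -lerBrDl.
Qed.

Lemma cent_kapn (R : realType)
  (lam : probability (fullshift * fullshift)%type R)
  (nu : probability fullshift R) n :
  invariant_on setT nu ->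
  (forall A, measurable A -> pushforward lam fst A = nu A) ->
  (forall t, law lam (@jword n) t = law lam (@xword n) t.1 * kapn t.1 t.2) ->
  cent lam n = n%:R * one_freq nu.
Proof.
move=> inv lamnu le; apply/eqP; rewrite /cent subr_eq addrC.
rewrite -(cross_entropy_kapn n inv lamnu); apply/eqP; apply: eq_bigr => t _.
by rewrite etaHE {2}le.
Qed.

Lemma cyl_at0 n (w : n.-tuple bool) : cyl_at 0 w = cyl w.
Proof. by rewrite eqEsubset; split => x h i; have := h i; rewrite add0r. Qed.

(** The word pair (x, y) has weight nu(x) 2^-n; it remains to sum over the y whose product with x is
    z. *)
Lemma product_law_jword (R : realType) (nu B : probability fullshift R)
  (lam : probability (fullshift * fullshift)%type R) n :
  bernoulli_half B -> (forall A, lam A = product_measure1 nu B A) ->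
  forall t, law lam (@jword n) t = law lam (@xword n) t.1 * kapn t.1 t.2.
Proof.
move=> hB lamE [x z].
have xE x' : law lam (@xword n) x' = law nu (@word n) x'.
  rewrite /law lamE (_ : _ @^-1` _ = (@word n @^-1` [set x']) `*` setT).
    rewrite product_measure1E//; last exact: fmeas_word.
    by rewrite [X in (_ * X)%E]probability_setT mule1.
  by rewrite eqEsubset; split => [p|p []].
have mxy : fmeas (fun p : fullshift * fullshift => (word n p.1, word n p.2)).
  apply: fmeas_pair; first exact: fmeas_xword.
  exact: (fmeas_precomp (@measurable_snd _ _ _ _) (@fmeas_word n)).
pose h (t : n.-tuple bool * n.-tuple bool) :=
  (t.1, [tuple tnth t.1 i && tnth t.2 i | i < n]).
rewrite (_ : @jword n = h \o (fun p => (word n p.1, word n p.2))); last first.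
  apply/funext => p; congr pair; apply: eq_from_tnth => i.
  by rewrite !tnth_mktuple.
rewrite (law_push lam h mxy) /push.
have yE x' y : law lam (fun p : fullshift * fullshift => (word n p.1, word n p.2))
    (x', y) = law nu (@word n) x' * 2^-1 ^+ n.
  rewrite /law lamE (_ : _ @^-1` _ = (@word n @^-1` [set x']) `*` cyl y).
    rewrite product_measure1E//; last by rewrite cylE; exact: fmeas_word.
      rewrite [X in (_ * X)%E](_ : _ = (2^-1 ^+ n)%:E); last first.
        by rewrite -cyl_at0 exprVn; exact: hB.
      by rewrite fineM//; apply: fin_num_measure; exact: fmeas_word.
    exact: fmeas_word.
  by rewrite cylE eqEsubset; split => [p [<- <-]|p [/= -> ->]].
rewrite (eq_bigl (fun t => (t.1 == x) && ([tuple tnth t.1 i && tnth t.2 i | i < n] == z)));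
  last by move=> t.
rewrite (eq_bigr (fun t => law lam
  (fun p : fullshift * fullshift => (word n p.1, word n p.2)) (t.1, t.2)));
  last by case.
rewrite -(pair_big_dep (pred1 x) (fun x' y => [tuple tnth x' i && tnth y i | i < n] == z)
  (fun x' y => law lam (fun p : fullshift * fullshift => (word n p.1, word n p.2)) (x', y)))/=.
rewrite big_pred1_eq xE.
under eq_bigr do rewrite yE.
rewrite -mulr_sumr; congr (_ * _).
rewrite big_mkcond/=.
(* The indicator of x y = z is a product over coordinates, so the sum over y factors. *)
transitivity (\sum_(y : n.-tuple bool)
    \prod_(i < n) (2^-1 * ((tnth x i && tnth y i) == tnth z i)%:R : R)).
  apply: eq_bigr => y _; rewrite big_split/= prodr_const card_ord.
  case: eqP => [<-|ne].
    by rewrite big1 ?mulr1// => i _; rewrite tnth_mktuple eqxx.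
  have [i hi] : exists i, (tnth x i && tnth y i) != tnth z i.
    apply: contrapT => /forallNP ne'; apply: ne; apply: eq_from_tnth => i.
    by rewrite tnth_mktuple; apply/eqP/negPn/negP; exact: ne'.
  by rewrite (bigD1 i)//= (negbTE hi) mul0r mulr0.
rewrite (sum_prod_tuple (fun i b => 2^-1 * ((tnth x i && b) == tnth z i)%:R)).
apply: eq_bigr => i _; rewrite big_bool/= /kap.
by case: (tnth x i); case: (tnth z i) => /=; rewrite ?mulr0 ?addr0 ?add0r ?mulr1//; field.
Qed.

(** * Fekete's lemma, ultrafilter limits and the Markov bound *)

(** The limit is the infimum: write n = q M + r with u M / M close to it; then u n is at most q u M
    plus a bounded remainder. *)
Lemma fekete (R : realType) (u : nat -> R) : (forall n, 0 <= u n) ->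
  (forall n m, u (n + m)%N <= u n + u m) ->
  exists l : R, (u n / n%:R @[n --> \oo] --> l) /\
    forall n, (0 < n)%N -> l <= u n / n%:R.
Proof.
move=> u0 usub; pose S := [set u n.+1 / n.+1%:R | n in setT].
have S0 : S !=set0 by exists (u 1%N / 1%:R), 0%N.
have lbS : has_lbound S by exists 0 => _ [n _ <-]; rewrite divr_ge0.
have infS : has_inf S by split.
have lb n : (0 < n)%N -> inf S <= u n / n%:R.
  by case: n => // n _; apply: ge_inf => //; exists n.
exists (inf S); split => //.
apply/cvgrPdist_le => e e0.
have e20 : 0 < e / 2 by rewrite divr_gt0.
have [_ [m _ <-] hm] := inf_adherent e20 infS.
(* [C] dominates every remainder [u (n %% M)], and n >= 2 C / e makes it at most n e / 2. *)
set M := m.+1; pose C := \sum_(r < M) u r.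
have uM q r : u (q * M + r)%N <= q%:R * u M + u r.
  elim: q => [|q IH]; first by rewrite mul0n mul0r add0n add0r.
  rewrite mulSn -addnA (le_trans (usub _ _))// -addn1 natrD mulrDl mul1r.
  by rewrite addrAC [leRHS]addrC lerD2l.
have M0 : 0 < M%:R :> R by rewrite ltr0n.
near=> n.
have n0 : (0 < n)%N by near: n; exact: nbhs_infty_gt.
have n0R : 0 < n%:R :> R by rewrite ltr0n.
have nC : 2 * C / e <= n%:R by near: n; exact: nbhs_infty_ger.
rewrite distrC ger0_norm ?subr_ge0 ?lb// lerBlDl.
have h1 : u n <= (n %/ M)%:R * u M + C.
  rewrite [in leLHS](divn_eq n M) (le_trans (uM _ _))// lerD2l.
  have rM : (n %% M < M)%N by rewrite ltn_mod.
  by rewrite /C (bigD1 (Ordinal rM))//= lerDl sumr_ge0.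
have h2 : (n %/ M)%:R <= n%:R / M%:R :> R.
  by rewrite ler_pdivlMr// -natrM ler_nat leq_trunc_div.
have h3 : (n %/ M)%:R * u M <= n%:R * (u M / M%:R).
  by rewrite mulrCA mulrC ler_wpM2l.
rewrite ler_pdivrMr//.
have h4 : n%:R * (u M / M%:R) <= n%:R * (inf S + e / 2).
  by rewrite ler_pM2l// ltW.
have h5 : C <= n%:R * (e / 2).
  by move: nC; rewrite ler_pdivrMr//; lra.
lra.
Unshelve. all: end_near. Qed.

(** Compactness of the segment gives a cluster point, and an ultrafilter converges to its cluster
    points. *)
Lemma ultra_bounded_cvg (R : realType) (T : Type) (F : set_system T)
  (UF : UltraFilter F) (f : T -> R) a b : (forall x, a <= f x <= b) ->
  exists l : R, f x @[x --> F] --> l.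
Proof.
move=> fab; have PF := @ultra_proper _ _ UF.
have [|l [_ cl]] := @segment_compact R a b (f x @[x --> F]) _.
  change (F (f @^-1` `[a, b]%classic)).
  by apply: (filterS _ filterT) => x _; rewrite /= in_itv/=; exact: fab.
exists l => V nV.
have [//|h] := in_ultra_setVsetC (f @^-1` V) UF.
by have [y [? ?]] := cl (~` V) V h nV.
Qed.

Lemma cvg_sub_filter (R : realType) (F : set_system nat) (f : nat -> R) (l : R) :
  \oo `<=` F -> f n @[n --> \oo] --> l -> f n @[n --> F] --> l.
Proof. by move=> sF fl A /fl; exact: sF. Qed.

(** Words as plain sequences, so that recursions may change the length freely; [val_word] relates
    them to tuples. *)
Definition sword k (x : fullshift) : seq bool := mkseq (fun i => x i%:Z) k.

Definition scyl (v : seq bool) : set fullshift := [set x | sword (size v) x = v].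

Lemma sword_cons k x : sword k.+1 x = x 0 :: sword k (Defs.shift x).
Proof.
rewrite /sword /mkseq /= -[1%N]addn0 iotaDl -map_comp; congr cons.
by apply: eq_map => i; rewrite /= /Defs.shift; congr x; lia.
Qed.

Lemma sword_rcons k x : sword k.+1 x = rcons (sword k x) (x k%:Z).
Proof. by rewrite /sword mkseq_rcons. Qed.

Lemma size_sword k x : size (sword k x) = k.
Proof. exact: size_mkseq. Qed.

Lemma val_word n x : val (word n x) = sword n x.
Proof.
apply: (@eq_from_nth _ false) => [|i]; rewrite size_tuple ?size_mkseq// => iN.
by rewrite nth_mkseq// -[i]/(val (Ordinal iN)) -tnth_nth tnth_mktuple.
Qed.

Lemma scyl_tuple n (w : n.-tuple bool) : scyl w = @word n @^-1` [set w].
Proof.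
rewrite eqEsubset /scyl size_tuple; split => x /=; rewrite -val_word.
  by move=> h; exact: val_inj.
by move=> <-.
Qed.

Lemma scyl_cons b v : scyl (b :: v) = [set x | x 0 = b] `&` Defs.shift @^-1` scyl v.
Proof.
rewrite eqEsubset /scyl; split => x; rewrite /= sword_cons; first by case=> -> ->.
by move=> [-> ->].
Qed.

Lemma finitary_scyl v : finitary (scyl v).
Proof.
exists (size v) => x y xy; rewrite /scyl/= => <-.
rewrite size_sword; apply/eq_in_map => i; rewrite mem_iota add0n => /andP[_ iv].
by rewrite xy//= ltnW.
Qed.

Lemma sum_tuple_cons (R : realType) n (F : seq bool -> R) :
  \sum_(w : n.+1.-tuple bool) F w =
  \sum_(u : n.-tuple bool) (F (false :: u) + F (true :: u)).
Proof.
rewrite (reindex (fun p : bool * n.-tuple bool => [tuple of p.1 :: p.2])).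
  rewrite -(pair_bigA _ (fun b (u : n.-tuple bool) => F (b :: u)))/=.
  by rewrite big_bool/= -big_split/=; apply: eq_bigr => u _; rewrite addrC.
exists (fun w : n.+1.-tuple bool => (thead w, [tuple of behead w])) => [[b u]|w] _ /=.
  by congr pair; apply: val_inj.
by rewrite [RHS]tuple_eta.
Qed.

(** * Markov chains as reference laws for words *)

Section MarkovBound.
Variables (R : realType) (p : seq bool -> R).
Hypothesis p_gt0 : forall v, 0 < p v.
Hypothesis p_cons : forall v, p (false :: v) + p (true :: v) = p v.

(* Probability of a word under the Markov chain of order [m] with transition
   probabilities given by [p], run from right to left and started uniformly. *)
Fixpoint markov m (u : seq bool) : R :=
  if u is b :: u' then
    markov m u' *
    if (size u' < m)%N then 2^-1 else p (b :: take m u') / p (take m u')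
  else 1.

(** The information carried by the first symbol of [v] given the rest. *)
Definition infoc (v : seq bool) : R := log2 (p (behead v)) - log2 (p v).

Lemma infoc_ge0 b v : 0 <= infoc (b :: v).
Proof.
rewrite subr_ge0 ler_log2//= -(p_cons v).
by case: b; rewrite ?lerDr ?lerDl ltW.
Qed.

Lemma markov_gt0 m u : 0 < markov m u.
Proof.
elim: u => //= b u IH; rewrite mulr_gt0//; case: ifP => _; first by rewrite invr_gt0.
by rewrite divr_gt0.
Qed.

Lemma sum_markov m n : \sum_(w : n.-tuple bool) markov m w = 1.
Proof.
elim: n => [|n IH].
  by rewrite (big_pred1 [tuple])// => w; apply/esym/eqP; exact: tuple0.
rewrite (sum_tuple_cons _ (markov m)) -[RHS]IH; apply: eq_bigr => u _ /=.
rewrite -mulrDr; case: ifP => _.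
  by rewrite (_ : _ + _ = 1) ?mulr1//; field.
by rewrite -mulrDl p_cons divff ?mulr1// gt_eqF.
Qed.

(** Chain rule: a step with a full past costs the information of a window of length m + 1, a
    start-up step one bit. The windows at start-up positions run past the word; their nonnegative
    terms only enlarge the bound. *)
Lemma log2_markov m n (x : fullshift) : - log2 (markov m (sword n x)) <=
  (minn n m)%:R + \sum_(i < n) infoc (sword m.+1 (iter i Defs.shift x)).
Proof.
elim: n x => [|n IH] x.
  by rewrite big_ord0 min0n addr0 /= log2_1 oppr0.
rewrite sword_cons /= log2M ?markov_gt0//; last first.
  by case: ifP => _; rewrite ?invr_gt0 ?divr_gt0.
rewrite opprD big_ord_recl/= size_sword.
have := IH (Defs.shift x).
under [in X in X -> _]eq_bigr do rewrite -iterSr.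
move=> h; case: ltnP => nm.
  rewrite log2V// log2_2 opprK (minn_idPl nm).
  rewrite (minn_idPl (ltnW nm)) in h.
  have h0 : 0 <= infoc (sword m.+1 x) by rewrite sword_cons infoc_ge0.
  by rewrite -addn1 natrD; lra.
rewrite (minn_idPr (leqW nm)); rewrite (minn_idPr nm) in h.
have tk : take m (sword n (Defs.shift x)) = sword m (Defs.shift x).
  by rewrite /sword /mkseq -map_take take_iota (minn_idPl nm).
rewrite log2M ?invr_gt0// log2V// tk.
rewrite [X in _ <= _ + (X + _)]/infoc sword_cons/=.
lra.
Qed.

(** The uniform law on [A] has entropy [log2 #|A|], and Gibbs' inequality compares it with the
    Markov law. The points [x w] extend the words, so that overhanging windows make sense. *)
Lemma log2_card_le m n (A : {set n.-tuple bool}) (x : n.-tuple bool -> fullshift) :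
  (0 < #|A|)%N -> (forall w, w \in A -> word n (x w) = w) ->
  log2 #|A|%:R <= m%:R + #|A|%:R^-1 *
    \sum_(w in A) \sum_(i < n) infoc (sword m.+1 (iter i Defs.shift (x w))).
Proof.
move=> A0 xA; have A0' : 0 < #|A|%:R :> R by rewrite ltr0n.
pose U (w : n.-tuple bool) : R := if w \in A then #|A|%:R^-1 else 0.
have U0 w : 0 <= U w by rewrite /U; case: ifP; rewrite ?invr_ge0.
have U1 : \sum_w U w = 1.
  by rewrite -big_mkcond/= sumr_const -[_ *+ _]mulr_natl mulfV// gt_eqF.
have -> : log2 #|A|%:R = ent U.
  rewrite /ent (eq_bigr (fun w => U w * log2 #|A|%:R)); last first.
    move=> w _; rewrite etaHE /U; case: ifP => _; last by rewrite !mul0r oppr0.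
    by rewrite log2V// mulrN opprK.
  by rewrite -mulr_suml U1 mul1r.
have := @gibbs R _ U (fun w : n.-tuple bool => markov m w) U0.
have k0 w : 0 <= markov m w by exact: ltW (markov_gt0 _ _).
move=> /(_ (fun w => k0 w)) h; apply: le_trans (h _ _) _.
- by move=> w /eqP; rewrite gt_eqF// markov_gt0.
- by rewrite sum_markov U1.
rewrite (eq_bigr (fun w => if w \in A then #|A|%:R^-1 * - log2 (markov m w) else 0));
  last first.
  by move=> w _; rewrite /U; case: ifP => _; rewrite ?mul0r ?oppr0// mulrN.
rewrite -big_mkcond/= -mulr_sumr.
apply: (@le_trans _ _ (#|A|%:R^-1 * \sum_(w in A) (m%:R +
   \sum_(i < n) infoc (sword m.+1 (iter i Defs.shift (x w)))))).
  rewrite ler_pM2l ?invr_gt0//; apply: ler_sum => w wA.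
  rewrite -[in leLHS](xA _ wA) val_word.
  by apply: le_trans (log2_markov _ _ _) _; rewrite lerD2r ler_nat geq_minr.
by rewrite big_split/= sumr_const mulrDr -[m%:R *+ _]mulr_natl mulKf// gt_eqF.
Qed.

End MarkovBound.

(** * Limits of empirical measures *)

Lemma subshift_iter (X : set fullshift) i x :
  subshift X -> X x -> X (iter i Defs.shift x).
Proof.
move=> [_ sX] Xx; elim: i => //= i IH.
by rewrite -sX; exists (iter i Defs.shift x).
Qed.

(** The mean of the point masses along the orbit segments of length n of the points [x w], evaluated
    on arbitrary sets. *)
Definition emp {R : realType} n (A : {set n.-tuple bool})
  (x : n.-tuple bool -> fullshift) (C : set fullshift) : R :=
  (#|A| * n)%:R^-1 *
  \sum_(w in A) \sum_(i < n) (`[< C (iter i Defs.shift (x w)) >])%:R.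

Lemma emp_fadditive (R : realType) n (A : {set n.-tuple bool}) x :
  (0 < n)%N -> (0 < #|A|)%N -> fadditive (@emp R n A x).
Proof.
move=> n0 A0; split.
- move=> C; rewrite mulr_ge0 ?invr_ge0//; apply: sumr_ge0 => w _.
  exact: sumr_ge0.
- rewrite /emp (eq_bigr (fun=> n%:R)) => [|w _]; last first.
    rewrite (eq_bigr (fun=> 1)) ?sumr_const ?card_ord// => i _.
    by rewrite (asboolT I).
  by rewrite sumr_const -mulrnA mulnC mulVf// pnatr_eq0 -lt0n muln_gt0 n0 A0.
- move=> C D CD; rewrite /emp -mulrDr -big_split/=; congr (_ * _).
  apply: eq_bigr => w _; rewrite -big_split/=; apply: eq_bigr => i _.
  set y := iter _ _ _; have CDy : ~ (C y /\ D y).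
    by move=> cd; have : (C `&` D) y by []; rewrite CD.
  have -> : `[< (C `|` D) y >] = `[< C y >] || `[< D y >] by rewrite -asbool_or.
  case: (asboolP (C y)) => Cy; case: (asboolP (D y)) => Dy; rewrite ?addr0 ?add0r//.
  by exfalso; apply: CDy.
Qed.

(** Shifting changes an orbit sum only through its two ends, hence by at most 1 for each word. *)
Lemma emp_shift (R : realType) n (A : {set n.-tuple bool}) x C :
  (0 < n)%N -> (0 < #|A|)%N ->
  `|@emp R n A x (Defs.shift @^-1` C) - emp A x C| <= n%:R^-1.
Proof.
move=> n0 A0; rewrite /emp -mulrBr normrM ger0_norm ?invr_ge0//.
rewrite natrM invfM mulrAC ler_piMl// mulrC ler_pdivrMr ?ltr0n// mul1r.
rewrite -sumrB (le_trans (ler_norm_sum _ _ _))//.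
rewrite -[leRHS]mulr1 mulr_natl -sumr_const; apply: ler_sum => w _.
case: n n0 A x A0 w => // n _ A x A0 w.
rewrite big_ord_recr big_ord_recl/=.
rewrite [X in _ - X]addrC opprD addrACA subrr add0r.
by do 2 case: asboolP => _; rewrite ?subrr ?normr0 ?subr0 ?sub0r ?normrN ?normr1.
Qed.

Lemma emp_full (R : realType) n (A : {set n.-tuple bool}) x (X C : set fullshift) :
  (0 < n)%N -> (0 < #|A|)%N -> subshift X -> (forall w, w \in A -> X (x w)) ->
  X `<=` C -> @emp R n A x C = 1.
Proof.
move=> n0 A0 sX xX XC; have [_ <- _] := @emp_fadditive R n A x n0 A0.
congr (_ * _); apply: eq_bigr => w wA; apply: eq_bigr => i _.
rewrite !asboolT//; apply: XC; apply: subshift_iter => //; exact: xX.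
Qed.

(** Visits are grouped by the word read there, which turns an orbit sum into an integral against the
    empirical measure. *)
Lemma sum_emp (R : realType) n k (A : {set n.-tuple bool}) x (f : seq bool -> R) :
  (0 < n)%N ->
  #|A|%:R^-1 * \sum_(w in A) \sum_(i < n) f (sword k (iter i Defs.shift (x w)))
  = n%:R * \sum_(v : k.-tuple bool) emp A x (scyl v) * f v.
Proof.
move=> n0; rewrite /emp.
under [in RHS]eq_bigr do rewrite -mulrA.
rewrite -mulr_sumr mulrA natrM invfM mulrCA divff ?mulr1; last first.
  by rewrite pnatr_eq0 -lt0n.
congr (_ * _); under [in RHS]eq_bigr do rewrite mulr_suml.
rewrite [RHS]exchange_big/=; apply: eq_bigr => w _.
under [in RHS]eq_bigr do rewrite mulr_suml.
rewrite [RHS]exchange_big/=; apply: eq_bigr => i _.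
rewrite (bigD1 (word k (iter i Defs.shift (x w))))//= big1 ?addr0.
  have e : [seq iter i Defs.shift (x w) j%:Z | j : 'I_k <- enum 'I_k] =
      sword k (iter i Defs.shift (x w)) := val_word k _.
  by rewrite e asboolT ?mul1r// /scyl/= size_sword.
move=> v /eqP vw; rewrite asboolF ?mul0r// scyl_tuple => h.
by apply: vw; rewrite -h.
Qed.

Lemma finitary_shift A : finitary A -> finitary (Defs.shift @^-1` A).
Proof.
move=> [N hA]; exists N.+1 => x y xy; apply: hA => i iN.
by apply: xy; move: iN; rewrite -!lez_nat; lia.
Qed.

(** The complement of [X] is a countable union of finitary sets, each null because its complement is
    finitary and contains [X]. *)
Lemma closed_full_measure (R : realType) (X : set fullshift_top)
  (P : probability fullshift R) : closed X ->
  (forall A : set fullshift, finitary A -> X `<=` A -> P A = 1%E) ->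
  P (X : set fullshift) = 1%E.
Proof.
move=> cX PX; have [F [finF XF]] := open_bigcup_finitary (closed_openC cX).
have mF N : measurable (F N) by exact: measurable_finitary.
have F0 N : P (F N) = 0%E.
  have fC : finitary (~` F N).
    have [M hM] := finF N; exists M => x y xy nFx Fy; apply: nFx.
    by apply: hM Fy; exact: agree_sym.
  have PC : P (~` F N) = 1%E.
    by apply: PX => // x Xx Fx; have : (~` X) x by rewrite XF; exists N.
  have mC : measurable (~` F N) by exact: measurableC.
  by rewrite -[F N]setCK probability_setC// PC subee.
have XC0 : P (~` X : set fullshift) = 0%E.
  rewrite XF; apply/eqP; rewrite -measure_le0.
  apply: le_trans (measure_sigma_subadditive P mF _ (@subset_refl _ _)) _.
    exact: bigcupT_measurable.
  by rewrite eseries0 => [|i _ _]; [exact: lexx|exact: F0].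
have mX : measurable (X : set fullshift) by exact: measurable_closed.
have mXC : measurable (~` X : set fullshift) by exact: measurableC.
by rewrite -[X in P X]setCK probability_setC// XC0 sube0.
Qed.

Lemma cvg_inv_nat (R : realType) : (n%:R : R)^-1 @[n --> \oo] --> (0 : R).
Proof.
apply/gtr0_cvgV0; last exact: cvgr_idn.
by near=> n; rewrite ltr0n; near: n; exact: nbhs_infty_gt.
Unshelve. all: end_near. Qed.

(** Limits along [F] exist for all sets at once and give a finitely additive [L]. The measure of
    [fadditive_extension] agrees with [L] on finitary sets, which suffice to test invariance and
    full mass on the closed set [X]. *)
Lemma limit_measure (R : realType) (X : set fullshift) (F : set_system nat)
  (x : forall n, n.-tuple bool -> fullshift) :
  UltraFilter F -> \oo `<=` F -> subshift X ->
  (forall n, (0 < #|lang X n|)%N) ->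
  (forall n w, w \in lang X n -> X (x n w)) ->
  exists mu : probability fullshift R, invariant_on X mu /\
    forall A, finitary A ->
      emp (lang X n) (x n) A @[n --> F] --> fine (mu A).
Proof.
move=> UF sF sX l0 xX; have PF := @ultra_proper _ _ UF.
have n_gt0 : \forall n \near F, (0 < n)%N by apply: sF; exact: nbhs_infty_gt.
pose e A n : R := emp (lang X n) (x n) A.
have e01 A n : 0 <= e A n <= 1.
  (* For n = 0 the orbit sums are empty and the value is 0, so the bounds hold for every n. *)
  rewrite /e; case: n => [|n].
    rewrite /emp big1 ?mulr0 ?lexx ?ler01// => w _.
    by rewrite big_ord0.
  have [h0 h1 hD] := emp_fadditive R (x n.+1) (ltn0Sn n) (l0 n.+1).
  rewrite h0 -h1 -(setUv A) hD ?setICr// lerDl h0//.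
have cvge A := ultra_bounded_cvg UF (e01 A).
have [L hL] := choice cvge.
have uniqL A l : e A n @[n --> F] --> l -> L A = l.
  move=> h; exact: (@cvg_unique _ (@Rhausdorff R) _ _ _ _ (hL A) h).
have fL : fadditive L.
  split.
  - move=> A; rewrite -(cvg_lim (@Rhausdorff R) (hL A)); apply: limr_ge.
      by apply: cvgP; exact: hL.
    by apply: nearW => n; have /andP[] := e01 A n.
  - apply: uniqL; apply: cvg_near_cst; apply: filterS n_gt0 => n n0; rewrite /e.
    by have [_ -> _] := emp_fadditive R (x n) n0 (l0 n).
  - move=> A C AC; apply: uniqL.
    have h : e A n + e C n @[n --> F] --> L A + L C by apply: cvgD; exact: hL.
    apply: cvg_trans h; apply: near_eq_cvg.
    apply: filterS n_gt0 => n n0; rewrite /e.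
    by have [_ _ ->] := emp_fadditive R (x n) n0 (l0 n).
have Linv A : L (Defs.shift @^-1` A) = L A.
  apply/eqP; rewrite -subr_eq0; apply/eqP.
  have h : e (Defs.shift @^-1` A) n - e A n @[n --> F] -->
      L (Defs.shift @^-1` A) - L A by apply: cvgB; exact: hL.
  apply: (@cvg_unique _ (@Rhausdorff R) _ _ _ _ h).
  have i0 : (n%:R : R)^-1 @[n --> F] --> 0.
    apply: (cvg_sub_filter sF); exact: cvg_inv_nat.
  have Ni0 : - (n%:R : R)^-1 @[n --> F] --> 0 by rewrite -oppr0; exact: cvgN.
  apply: (squeeze_cvgr _ Ni0 i0).
  apply: filterS n_gt0 => n n0; rewrite -ler_norml.
  exact: emp_shift.
have LX A : X `<=` A -> L A = 1.
  move=> XA; apply: uniqL; apply: cvg_near_cst; apply: filterS n_gt0 => n n0.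
  by rewrite /e (emp_full _ n0 (l0 n) sX _ XA)//; exact: xX.
have [mu hmu] := fadditive_extension fL.
exists mu; split; last by move=> A fA; rewrite hmu//=; exact: hL.
split.
  apply: closed_full_measure; first by case: sX.
  by move=> A fA XA; rewrite hmu// LX.
have [Q hQ] := probability_pushforward mu measurable_shift.
move=> A mA; rewrite -hQ.
apply: eq_probability_finitary => //; try exact: probability_setT.
move=> C fC; apply: (eq_trans (hQ C)).
apply: (eq_trans (hmu _ (finitary_shift fC))); rewrite Linv.
exact: (esym (hmu _ fC)).
Unshelve. all: end_near. Qed.

(** Dividing [log2_card_le] by n and passing to the limit bounds [c] by the increment of a cross
    entropy; these increments telescope. *)
Lemma limit_entropy (R : realType) (X : set fullshift) (F : set_system nat)
  (x : forall n, n.-tuple bool -> fullshift) (mu : probability fullshift R)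
  (c : R) m :
  UltraFilter F -> \oo `<=` F ->
  (forall n, (0 < #|lang X n|)%N) ->
  (forall n w, w \in lang X n -> word n (x n w) = w) ->
  invariant_on X mu ->
  (forall A, finitary A -> emp (lang X n) (x n) A @[n --> F] --> fine (mu A)) ->
  (\forall n \near F, c <= log2 #|lang X n|%:R / n%:R) ->
  m%:R * c <= Hn mu m + 1.
Proof.
move=> UF sF l0 xw [_ inv] hmu cF; have PF := @ultra_proper _ _ UF.
have n_gt0 : \forall n \near F, (0 < n)%N by apply: sF; exact: nbhs_infty_gt.
pose L v : R := fine (mu (scyl v)).
(* Mixing with the uniform measure makes every cylinder positive and keeps consistency. *)
pose p v : R := (L v + 2^-1 ^+ size v) / 2.
have mv v : measurable (scyl v) by apply: measurable_finitary; exact: finitary_scyl.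
have L0 v : 0 <= L v by exact: fine_ge0.
have L1 : L [::] = 1.
  by rewrite /L (_ : scyl _ = setT) ?probability_setT// eqEsubset.
have LC v : L (false :: v) + L (true :: v) = L v.
  rewrite /L -fineD ?fin_num_measure// -measureU//.
    rewrite -(inv (scyl v))//; congr (fine (mu _)).
    rewrite !scyl_cons -setIUl (_ : _ `|` _ = setT) ?setTI//.
    by rewrite eqEsubset; split => // y _ /=; case: (y 0); [right|left].
  by rewrite !scyl_cons eqEsubset; split => // y [[/= -> _] []].
have p_gt0 v : 0 < p v by rewrite divr_gt0// ltr_wpDl// exprn_gt0// invr_gt0.
have p_nil : p [::] = 1 by rewrite /p L1 /= expr0; field.
have p_cons v : p (false :: v) + p (true :: v) = p v.
  by rewrite /p /= -(LC v) exprS; lra.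
pose D k := \sum_(v : k.-tuple bool) - (L v * log2 (p v)).
have step k : c <= D k.+1 - D k.
  have -> : D k.+1 - D k = \sum_(v : k.+1.-tuple bool) L v * infoc p v.
    rewrite /infoc; under [RHS]eq_bigr do rewrite mulrBr.
    rewrite sumrB /D !sumrN opprK addrC; congr (_ - _).
    rewrite (sum_tuple_cons _ (fun v => L v * log2 (p (behead v))))/=.
    by apply: eq_bigr => u _; rewrite -mulrDl LC.
  (* The start-up cost of k bits, divided by n, vanishes in the limit. *)
  have h1 : k%:R * (n%:R : R)^-1 + \sum_(v : k.+1.-tuple bool)
      emp (lang X n) (x n) (scyl v) * infoc p v @[n --> F] -->
      k%:R * 0 + \sum_(v : k.+1.-tuple bool) L v * infoc p v.
    apply: cvgD.
      apply: cvgMr; apply: (cvg_sub_filter sF); exact: cvg_inv_nat.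
    apply: cvg_big => [|v _]; first exact: add_continuous.
    by apply: cvgMl; apply: hmu; exact: finitary_scyl.
  rewrite mulr0 add0r in h1.
  rewrite -(cvg_lim (@Rhausdorff R) h1); apply: limr_ge; first exact: cvgP h1.
  apply: (@filterS2 _ F _ _ _ _ _ n_gt0 cF) => n n0 cn.
  apply: le_trans cn _; rewrite ler_pdivrMr ?ltr0n//.
  have := log2_card_le p_gt0 p_cons k (l0 n) (xw n).
  rewrite (sum_emp _ _ _ _ n0) => /le_trans; apply.
  by rewrite mulrDl divfK ?pnatr_eq0 -?lt0n// mulrC.
have mD : m%:R * c <= D m.
  elim: m => [|k IH].
    rewrite mul0r /D (big_pred1 [tuple]) /= ?p_nil ?log2_1 ?mulr0 ?oppr0//.
    by move=> w; apply/esym/eqP; exact: tuple0.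
  by rewrite -addn1 natrD mulrDl mul1r; have := step k; rewrite addn1; lra.
apply: le_trans mD _; rewrite HnE.
have s1 : \sum_(v : m.-tuple bool) L v = 1.
  rewrite -(sum_law mu (@fmeas_word m)); apply: eq_bigr => v _.
  by rewrite /L scyl_tuple.
rewrite -s1 /ent -big_split/=; apply: ler_sum => v _.
have -> : law mu (@word m) v = L v by rewrite /L scyl_tuple.
rewrite etaHE; have [->|LN0] := eqVneq (L v) 0; first by rewrite !mul0r addr0.
have Lv : 0 < L v by rewrite lt_neqAle eq_sym LN0 L0.
(* As [p] is at least half of [L], replacing [L] by [p] costs at most one bit, the final + 1. *)
have h : log2 (L v / 2) <= log2 (p v).
  by rewrite ler_log2 ?divr_gt0// ler_pM2r ?invr_gt0// lerDl exprn_ge0// invr_ge0.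
rewrite log2M ?invr_gt0// log2V// log2_2 in h.
have := ler_wpM2l (L0 v) h; rewrite mulrBr mulr1; lra.
Unshelve. all: end_near. Qed.

(** * Entropy of the subshift *)

Lemma invariant_onT (R : realType) (X : set fullshift)
  (mu : probability fullshift R) : invariant_on X mu -> invariant_on setT mu.
Proof. by move=> [_ inv]; split => //; exact: probability_setT. Qed.

Lemma fmeas_window N : fmeas (window N).
Proof.
apply: (@fmeas_ffun _ _ _ _ (fun (i : 'I_(N.*2.+1)) (x : fullshift) =>
  x (i%:Z - N%:Z))) => i.
exact: measurable_coord.
Qed.

Lemma eq_probability_window (R : realType) (m1 m2 : probability fullshift R) :
  (forall N, law m1 (window N) =1 law m2 (window N)) ->
  forall A, measurable A -> m1 A = m2 A.
Proof.
move=> m12; apply: eq_probability_finitary; try exact: probability_setT.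
move=> A [N hA].
pose S := [pred s | `[< (window N @` A) s >]].
have -> : A = window N @^-1` [set s | S s].
  rewrite eqEsubset; split => x /=; first by move=> Ax; apply/asboolP; exists x.
  by move/asboolP => [y Ay /windowP xy]; exact: hA Ay.
have mS : measurable (window N @^-1` [set s | S s]).
  exact: (fmeas_preimage [set s | S s] (@fmeas_window N)).
rewrite -[LHS]fineK ?fin_num_measure// -[RHS]fineK ?fin_num_measure//.
congr EFin; rewrite !(fine_prob_preimage _ S (@fmeas_window N)).
by apply: eq_bigr => s _; exact: m12.
Qed.

(** The window of radius N of the point shifted N times is its word of length 2 N + 1, and
    invariance removes the shift. *)
Lemma eq_invariant_word (R : realType) (m1 m2 : probability fullshift R) :
  invariant_on setT m1 -> invariant_on setT m2 ->
  (forall n, (0 < n)%N -> law m1 (@word n) =1 law m2 (@word n)) ->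
  forall A, measurable A -> m1 A = m2 A.
Proof.
move=> [_ inv1] [_ inv2] m12; apply: eq_probability_window => N s.
have [_ <-] := law_iter N measurable_shift inv1 (@fmeas_window N).
have [_ <-] := law_iter N measurable_shift inv2 (@fmeas_window N).
have -> : window N \o iter N Defs.shift =
    (fun w : N.*2.+1.-tuple bool => [ffun i => tnth w i]) \o @word N.*2.+1.
  apply/funext => x; apply/ffunP => i; rewrite !ffunE /= tnth_mktuple iter_shiftE.
  by congr x; lia.
rewrite !(law_push _ _ (@fmeas_word N.*2.+1)).
by apply: eq_bigr => w _; exact: m12.
Qed.

Lemma bernoulli_half_invariant (R : realType) (B : probability fullshift R) :
  bernoulli_half B -> invariant_on setT B.
Proof.
move=> hB; split; first exact: probability_setT.
have [Q hQ] := probability_pushforward B measurable_shift.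
move=> A mA; apply: (eq_trans (esym (hQ A))).
apply: eq_probability_window => // N s; rewrite /law; congr (fine _).
apply: (eq_trans (hQ _)).
pose w : N.*2.+1.-tuple bool := [tuple s i | i < N.*2.+1].
have wE : window N @^-1` [set s] = cyl_at (- N%:Z) w.
  rewrite eqEsubset; split => x /=.
    by move=> ws i; rewrite tnth_mktuple -ws ffunE addrC.
  by move=> h; apply/ffunP => i; rewrite ffunE addrC h tnth_mktuple.
have wS : Defs.shift @^-1` cyl_at (- N%:Z) w = cyl_at (- N%:Z + 1) w.
  by rewrite eqEsubset; split => x h i; have := h i; rewrite /Defs.shift addrAC.
by rewrite wE wS; apply: (eq_trans (hB _ _ _)); exact: (esym (hB _ _ _)).
Qed.

Lemma product_invariant2 (R : realType) (nu B : probability fullshift R)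
  (lam : probability (fullshift * fullshift)%type R) :
  invariant_on setT nu -> invariant_on setT B ->
  (forall A, lam A = product_measure1 nu B A) -> invariant2 lam.
Proof.
move=> [_ invnu] [_ invB] lamE A mA.
have [Q hQ] := probability_pushforward lam measurable_shift2.
apply: (eq_trans (esym (hQ A))); rewrite lamE.
apply/esym; apply: (@product_measure_unique _ _ _ _ R nu B Q) => // A1 A2 m1 m2.
apply: (eq_trans (hQ _)); rewrite lamE.
rewrite (_ : shift2 @^-1` _ = (Defs.shift @^-1` A1) `*` (Defs.shift @^-1` A2))//.
rewrite product_measure1E; [|exact: measurable_preimage measurable_shift m1|
  exact: measurable_preimage measurable_shift m2].
by congr (_ * _)%E; [exact: invnu|exact: invB].
Qed.

Lemma law_xword (R : realType) (nu : probability fullshift R)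
  (lam : probability (fullshift * fullshift)%type R) n :
  (forall A, measurable A -> pushforward lam fst A = nu A) ->
  law lam (@xword n) =1 law nu (@word n).
Proof. by move=> h w; congr (fine _); apply: h; exact: fmeas_word. Qed.

Lemma law_zword (R : realType) (mu : probability fullshift R)
  (lam : probability (fullshift * fullshift)%type R) n :
  (forall A, measurable A -> pushforward lam mulM A = mu A) ->
  law lam (@word n \o mulM) =1 law mu (@word n).
Proof. by move=> h w; congr (fine _); apply: h; exact: fmeas_word. Qed.

(** H(z) <= H(x, z) = H(x) + H(z | x). *)
Lemma Hn_le_cent (R : realType) (nu mu : probability fullshift R)
  (lam : probability (fullshift * fullshift)%type R) n :
  (forall A, measurable A -> pushforward lam fst A = nu A) ->
  (forall A, measurable A -> pushforward lam mulM A = mu A) ->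
  Hn mu n <= Hn nu n + cent lam n.
Proof.
move=> h1 h2; rewrite !HnE -(eq_ent (@law_xword _ _ _ n h1)) -(eq_ent (@law_zword _ _ _ n h2)).
rewrite /cent addrC subrK.
exact: (ent_law_comp_le lam snd (@fmeas_jword n)).
Qed.

Lemma cent_le_Hn (R : realType) (mu : probability fullshift R)
  (lam : probability (fullshift * fullshift)%type R) n :
  (forall A, measurable A -> pushforward lam mulM A = mu A) ->
  cent lam n <= Hn mu n.
Proof.
move=> h2; rewrite HnE -(eq_ent (@law_zword _ _ _ n h2)) /cent lerBlDl.
exact: (ent_law_pair_le lam (@fmeas_xword n) (@fmeas_zword n)).
Qed.

Lemma mem_lang (X : set fullshift) n x : X x -> word n x \in lang X n.
Proof.
by move=> Xx; rewrite inE; apply/asboolP; exists x => //; rewrite cylE.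
Qed.

Lemma Hn_le_lang (R : realType) (X : set fullshift) (mu : probability fullshift R)
  n : measurable X -> mu X = 1%E -> Hn mu n <= log2 #|lang X n|%:R.
Proof.
move=> mX muX; rewrite HnE; apply: ent_le_log_card.
- by move=> w; exact: law_ge0.
- by apply: sum_law; exact: fmeas_word.
- move=> w; apply: contraNT => wX; rewrite /law.
  have mw := @fmeas_word n w.
  suff -> : mu (@word n @^-1` [set w]) = 0%E by [].
  apply/eqP; rewrite -measure_le0.
  have <- : mu (~` X) = 0%E by rewrite probability_setC// muX subee.
  apply: le_measure; rewrite ?inE//; first exact: measurableC.
  move=> x /= xw Xx; move/negP: wX; apply.
  by rewrite -xw; exact: mem_lang.
Qed.

(** [ment] is a [limn]; Fekete's lemma shows that the sequence converges and that the limit is a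
    lower bound. *)
Lemma ment_cvg (R : realType) (mu : probability fullshift R) :
  invariant_on setT mu ->
  (Hn mu n / n%:R @[n --> \oo] --> (ment mu : R)) /\
  forall n, (0 < n)%N -> ment mu <= Hn mu n / n%:R.
Proof.
move=> inv.
have [l [hl h]] := fekete (Hn_ge0 mu) (fun n m => Hn_subadd n m inv).
suff <- : l = ment mu by [].
by apply/esym; exact: (cvg_lim (@Rhausdorff R) hl).
Qed.

(** If the bound failed infinitely often, the limit measure along an ultrafilter on those lengths
    would come from a joining, giving m (nu(1) + e) <= H_m(nu) + m nu(1) + 1 for all m, against
    H_m(nu) = o(m). *)
Lemma htop_upper (R : realType) (X : set fullshift) (nu : probability fullshift R)
  (e : R) : invariant_on setT nu -> mt_subordinate X nu -> ment nu = 0 ->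
  X !=set0 -> 0 < e ->
  \forall n \near \oo, log2 #|lang X n|%:R / n%:R < one_freq nu + e.
Proof.
move=> invnu [sX hX] nu0 [x0 Xx0] e0; apply: contrapT => nh.
set S := [set n : nat | one_freq nu + e <= log2 #|lang X n|%:R / n%:R].
(* The bad set [S] meets every neighbourhood of infinity, so an ultrafilter finer than [\oo]
   contains it. *)
have PF : ProperFilter (within S \oo).
  apply: Build_ProperFilter_ex => P hP; apply: contrapT => /forallNP nP.
  have {}hP : \forall n \near \oo, S n -> P n by exact: hP.
  apply: nh; apply: filterS hP => n hn; rewrite ltNge; apply/negP => Sn.
  exact: (nP n (hn Sn)).
have [F [UF sub]] := ultraFilterLemma PF.
have sF : \oo `<=` F.
  by move=> A hA; apply: sub; apply: filterS hA => n An _.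
have SF : F S by apply: sub; exact: withinT.
have [x hx] : exists x : forall n, n.-tuple bool -> fullshift,
    forall n w, w \in lang X n -> X (x n w) /\ word n (x n w) = w.
  (* Each word of the language is extended to a point of [X]; other words get the default [x0]. *)
  have h n (w : n.-tuple bool) : exists y, w \in lang X n -> X y /\ word n y = w.
    have [|wX] := boolP (w \in lang X n); last by exists x0.
    by rewrite inE => /asboolP[y Xy]; rewrite cylE => yw; exists y.
  exists (fun n w => sval (cid (h n w))) => n w.
  by case: (cid _).
have l0 n : (0 < #|lang X n|)%N.
  by apply/card_gt0P; exists (word n x0); exact: mem_lang.
have [mu [invmu hmu]] := limit_measure R UF sF sX l0
  (fun n w wX => proj1 (hx n w wX)).
have [lam [invl [l1 l2]]] := iffLR (hX mu) invmu.
have main m : m%:R * e <= Hn nu m + 1.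
  have := limit_entropy m UF sF l0 (fun n w wX => proj2 (hx n w wX)) invmu hmu SF.
  have := Hn_le_cent m l1 l2; have := cent_le m invnu l1.
  by rewrite mulrDr; lra.
have [cvgnu _] := ment_cvg invnu; rewrite nu0 in cvgnu.
have e2 : 0 < e / 4 by rewrite divr_gt0.
have : \forall m \near \oo, False.
  near=> m.
  have m0 : (0 < m)%N by near: m; exact: nbhs_infty_gt.
  have m0R : 0 < m%:R :> R by rewrite ltr0n.
  have h1 : Hn nu m / m%:R < e / 4.
    near: m; exact: (cvgr_lt _ cvgnu).
  have h2 : (m%:R : R)^-1 < e / 4 by near: m; exact: (cvgr_lt _ (@cvg_inv_nat R)).
  have := main m; rewrite -(ler_pM2r (_ : 0 < m%:R^-1 :> R)) ?invr_gt0//.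
  rewrite mulrDl mul1r mulrAC divff ?gt_eqF// mul1r; lra.
by move=> [m _ /(_ m (leqnn m))].
Unshelve. all: end_near. Qed.

(** Maximal entropy of [mu] forces equality in [cent_le] at every block length, so the law of the
    z-word is determined by [nu]. *)
Lemma mme_word (R : realType) (nu mu : probability fullshift R)
  (lam : probability (fullshift * fullshift)%type R) n :
  invariant_on setT nu -> ment nu = 0 -> invariant2 lam ->
  (forall A, measurable A -> pushforward lam fst A = nu A) ->
  (forall A, measurable A -> pushforward lam mulM A = mu A) ->
  (forall n, n%:R * one_freq nu <= Hn mu n) -> (0 < n)%N ->
  forall z, law mu (@word n) z = \sum_x law nu (@word n) x * kapn x z.
Proof.
move=> invnu nu0 invl l1 l2 hmu n0 z.
have [cvgnu _] := ment_cvg invnu; rewrite nu0 in cvgnu.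
have n0R : 0 < n%:R :> R by rewrite ltr0n.
have ce : n%:R * one_freq nu <= cent lam n.
  (* A block of length (N + 1) n, long enough for H(nu) to be negligible, has nearly maximal [cent];
     [cent_muln] carries this down to length n. *)
  apply/ler_addgt0Pr => e e0.
  have e1 : 0 < e / n%:R by rewrite divr_gt0.
  have [N _ hN] : \forall k \near \oo, Hn nu k / k%:R < e / n%:R.
    exact: (cvgr_lt _ cvgnu).
  have NN : (N <= N.+1 * n)%N by rewrite (leq_trans (leqnSn N))// leq_pmulr.
  have K0 : 0 < (N.+1 * n)%:R :> R by rewrite ltr0n muln_gt0.
  have E : e / n%:R * (N.+1 * n)%:R = N.+1%:R * e.
    by rewrite natrM; field; rewrite pnatr_eq0 -lt0n.
  have := hN _ NN; rewrite /= ltr_pdivrMr// E.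
  have := hmu (N.+1 * n)%N; have := Hn_le_cent (N.+1 * n) l1 l2.
  have := cent_muln N n invl.
  rewrite [in X in _ -> _ -> X -> _]natrM => h1 h2 h3 h4.
  have N0 : 0 < N.+1%:R :> R by [].
  rewrite -(ler_pM2l N0) mulrDr mulrA.
  lra.
have je := cent_eq invnu l1 ce.
rewrite -(@law_zword _ _ _ n l2) (law_push lam snd (@fmeas_jword n)) /push.
rewrite (eq_bigl (fun t => xpredT t.1 && (t.2 == z)))//.
rewrite (eq_bigr (fun t => law nu (@word n) t.1 * kapn t.1 t.2)); last first.
  by move=> t _; rewrite je (@law_xword _ _ _ n l1).
rewrite -(pair_big xpredT (pred1 z) (fun x z => law nu (@word n) x * kapn x z))/=.
by apply: eq_bigr => x _; rewrite big_pred1_eq.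
Qed.

Theorem theorem5p1 (R : realType) (X : set fullshift)
    (nu : probability fullshift R) (B : probability fullshift R) :
  invariant_on setT nu ->
  mt_subordinate X nu ->
  ment nu = 0 ->
  bernoulli_half B ->
  htop X = one_freq nu /\
  intrinsically_ergodic (R := R) X /\
  (forall mu : probability fullshift R, is_mme X mu ->
     forall A, measurable A ->
       mu A = pushforward (product_measure1 nu B) mulM A).
Proof.
move=> invnu hXnu nu0 hB; have [sX hX] := hXnu.
pose lam0 : probability (fullshift * fullshift)%type R := product_measure1 nu B.
have lamE A : lam0 A = product_measure1 nu B A by [].
have invl := product_invariant2 invnu (bernoulli_half_invariant hB) lamE.
have l1 A : measurable A -> pushforward lam0 fst A = nu A.
  move=> mA; rewrite /pushforward (_ : fst @^-1` A = A `*` setT).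
    rewrite [LHS]product_measure1E// [X in (_ * X)%E](_ : _ = 1%E) ?mule1//.
    exact: probability_setT.
  by rewrite eqEsubset; split => [p|p []].
have [mu0 hmu0] := probability_pushforward lam0 measurable_mulM.
have l2 A : measurable A -> pushforward lam0 mulM A = mu0 A.
  by move=> _; rewrite hmu0.
have invmu0 : invariant_on X mu0 by apply/hX; exists lam0.
have mX : measurable X by case: sX => cX _; exact: measurable_closed.
(* A set carrying a probability is nonempty. *)
have X0 : X !=set0.
  apply/set0P/eqP => X0; case: invmu0 => + _; rewrite X0 measure0.
  by move=> /eqP; rewrite eq_sym onee_eq0.
have lowmu0 n : n%:R * one_freq nu <= Hn mu0 n.
  rewrite -(cent_kapn invnu l1 (product_law_jword hB lamE)).
  exact: cent_le_Hn.
have Hlang mu n : invariant_on X mu -> Hn mu n <= log2 #|lang X n|%:R.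
  by move=> [muX _]; exact: Hn_le_lang.
(* The entropy of [mu0] bounds the growth rate from below and [htop_upper] from above, so the [limn]
   in [htop] is a genuine limit. *)
have cvgX : log2 #|lang X n|%:R / n%:R @[n --> \oo] --> one_freq nu.
  apply/cvgrPdist_le => e e0; near=> n.
  have n0 : (0 < n)%N by near: n; exact: nbhs_infty_gt.
  have n0R : 0 < n%:R :> R by rewrite ltr0n.
  have h1 : one_freq nu <= log2 #|lang X n|%:R / n%:R.
    by rewrite ler_pdivlMr// mulrC (le_trans (lowmu0 n))// Hlang.
  have h2 : log2 #|lang X n|%:R / n%:R < one_freq nu + e.
    by near: n; exact: htop_upper.
  by rewrite distrC ger0_norm ?subr_ge0//; lra.
have htopE : htop X = one_freq nu by exact: (cvg_lim (@Rhausdorff R) cvgX).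
have mme0 : is_mme X mu0.
  split => //; rewrite htopE; apply: (cvg_lim (@Rhausdorff R)).
  apply: (squeeze_cvgr _ (cvg_cst (one_freq nu)) cvgX).
  near=> n.
  have n0 : (0 < n)%N by near: n; exact: nbhs_infty_gt.
  have n0R : 0 < n%:R :> R by rewrite ltr0n.
  rewrite ler_pdivlMr// mulrC lowmu0/= ler_pM2r ?invr_gt0//.
  exact: Hlang.
have uniq mu : is_mme X mu -> forall A, measurable A ->
    mu A = pushforward (product_measure1 nu B) mulM A.
  move=> [invmu mmu] A mA.
  have [lam [invl' [l1' l2']]] := iffLR (hX mu) invmu.
  have low n : n%:R * one_freq nu <= Hn mu n.
    (* Length 0 is treated apart because the lower bound of [ment_cvg] is for positive lengths. *)
    case: n => [|n]; first by rewrite mul0r Hn_ge0.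
    have [_ h] := ment_cvg (invariant_onT invmu).
    have := h n.+1 isT; rewrite mmu htopE ler_pdivlMr// => hh.
    by rewrite mulrC.
  transitivity (mu0 A); last by rewrite hmu0.
  apply: eq_invariant_word => //; [exact: invariant_onT invmu|
    exact: invariant_onT invmu0|].
  (* Both word laws equal the same expression in [nu]. *)
  move=> n n0 z; rewrite (mme_word invnu nu0 invl' l1' l2' low n0).
  by rewrite (mme_word invnu nu0 invl l1 l2 lowmu0 n0).
split => //; split => //; split; first by exists mu0.
by move=> m1 m2 h1 h2 A mA; rewrite (uniq _ h1 _ mA) (uniq _ h2 _ mA).
Unshelve. all: end_near. Qed.
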